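(* Let $K$ be a field and $c\ge 1$ an integer. If $\mathbf{M}$ is a finitely generated graded $\mathrm{FI}$-module over $(\mathbf{X}^{\mathrm{FI},1})^{\otimes c}$ that is generated in non-negative degrees, then its equivariant Hilbert series is of the form \[ H_{\mathbf{M}} (s, t) = \frac{g(s, t)}{(1-t)^a \cdot \prod_{j =1}^b [(1-t)^{c_j} - s \cdot f_j (t)]}, \] where $a, b, c_j$ are non-negative integers with $c_j \le c$, $g (s, t) \in \mathbb{Z}[s, t]$, and each $f_j (t)$ is a polynomial in $\mathbb{Z}[t]$ satisfying $f_j (1) > 0$ and $f_j (0) = 1$.
   Context: $\mathrm{FI}$ is (the skeleton of) the category of finite sets and injections: objects $[n] = \{1,\dots,n\}$, $n \ge 0$ ($[0]=\emptyset$), and morphisms the injective maps $\varepsilon\colon [m]\to[n]$. The $\mathrm{FI}$-algebra $\mathbf{P} = (\mathbf{X}^{\mathrm{FI},1})^{\otimes c}$ over $K$ is the functor from $\mathrm{FI}$ to commutative $K$-algebras with $\mathbf{P}_n = K[x_{i,j} : 1\le i\le c,\ 1\le j\le n]$ (so $\mathbf{P}_0=K$) and, for $\varepsilon\colon[m]\to[n]$, $\varepsilon_*\colon \mathbf{P}_m\to\mathbf{P}_n$ the $K$-algebra homomorphism with $\varepsilon_*(x_{i,j}) = x_{i,\varepsilon(j)}$. Every variable has degree one. An $\mathrm{FI}$-module $\mathbf{M}$ over $\mathbf{P}$ is a functor from $\mathrm{FI}$ to $K$-vector spaces such that each $\mathbf{M}_n = \mathbf{M}([n])$ is a $\mathbf{P}_n$-module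 and $\mathbf{M}(\varepsilon)(aq) = \varepsilon_*(a)\,\mathbf{M}(\varepsilon)(q)$ for all $\varepsilon\colon[m]\to[n]$, $a\in\mathbf{P}_m$, $q\in\mathbf{M}_m$. It is graded if every $\mathbf{M}_n$ is a $\mathbb{Z}$-graded $\mathbf{P}_n$-module and every $\mathbf{M}(\varepsilon)$ is homogeneous of degree $0$. A subset of $\coprod_n\mathbf{M}_n$ generates $\mathbf{M}$ if it is not contained in any proper $\mathrm{FI}$-submodule; $\mathbf{M}$ is finitely generated if it has a finite generating set, and generated in non-negative degrees if it has a generating set consisting of homogeneous elements of non-negative degrees. $[\mathbf{M}_n]_j$ is the degree $j$ component of $\mathbf{M}_n$. The equivariant Hilbert series is the formal power series $H_{\mathbf{M}}(s,t) = \sum_{n\ge0,\,j\in\mathbb{Z}} \dim_K[\mathbf{M}_n]_j\, s^n t^j$. *)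

(* Defs.v *)
From HB Require Import structures.
From mathcomp Require Import all_boot all_order all_algebra.
From mathcomp Require Import mpoly.

Set Implicit Arguments.
Unset Strict Implicit.
Unset Printing Implicit Defensive.

Import Order.TTheory GRing.Theory Num.Theory.
Local Open Scope ring_scope.

(* The category FI, with objects [n] rendered as 'I_n (so [0] is empty). *)

Record finj (m n : nat) := FInj {
  finj_fun :> {ffun 'I_m -> 'I_n};
  finj_injectiveb : injectiveb finj_fun
}.

HB.instance Definition _ m n := [isSub for @finj_fun m n].
HB.instance Definition _ m n := [Finite of finj m n by <:].

Lemma finjP m n (e : finj m n) : injective e.
Proof. exact/injectiveP/finj_injectiveb. Qed.

Lemma finj_id_subproof n : injectiveb [ffun i : 'I_n => i].
Proof. by apply/injectiveP; move=> i j; rewrite !ffunE. Qed.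

Definition finj_id n : finj n n := FInj (@finj_id_subproof n).

Lemma finj_comp_subproof l m n (e2 : finj m n) (e1 : finj l m) :
  injectiveb [ffun i : 'I_l => e2 (e1 i)].
Proof. by apply/injectiveP; move=> i j; rewrite !ffunE => /finjP /finjP. Qed.

Definition finj_comp l m n (e2 : finj m n) (e1 : finj l m) : finj l n :=
  FInj (@finj_comp_subproof l m n e2 e1).

(* The FI-algebra P = (X^{FI,1})^{\otimes c}.  The c * n variables x_{i,j}    *)
(* are numbered by mxvec_index : 'I_c -> 'I_n -> 'I_(c * n), a bijection from *)
(* pairs of indices.                                                          *)

Notation fiP K c n := {mpoly K[(c * n)%N]}.

Definition fiX (K : fieldType) (c n : nat) (i : 'I_c) (j : 'I_n) : fiP K c n :=
  'X_(mxvec_index i j).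

Definition fiP_map (K : fieldType) (c m n : nat) (e : finj m n)
    (p : fiP K c m) : fiP K c n :=
  p \mPo [tuple mxvec (\matrix_(i < c, j < m) fiX K i (e j)) 0 k | k < (c * m)%N].

Lemma fiP_mapX (K : fieldType) (c m n : nat) (e : finj m n) i j :
  fiP_map e (fiX K i j) = fiX K i (e j) :> fiP K c n.
Proof. by rewrite /fiP_map comp_mpolyXU -tnth_nth tnth_mktuple mxvecE mxE. Qed.

(* Each M_n is a K-vector space by restriction of scalars along K -> P_n, and *)
(* additivity together with semilinearity over the constants of P_m makes     *)
(* every M(e) K-linear.                                                       *)

Record fiModule (K : fieldType) (c : nat) := FIModule {
  fim_obj :> forall n, lmodType (fiP K c n);
  fim_map : forall m n, finj m n -> fim_obj m -> fim_obj n;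
  fim_map_id : forall n (q : fim_obj n), fim_map (finj_id n) q = q;
  fim_map_comp : forall l m n (e2 : finj m n) (e1 : finj l m) (q : fim_obj l),
    fim_map (finj_comp e2 e1) q = fim_map e2 (fim_map e1 q);
  fim_mapD : forall m n (e : finj m n) (q r : fim_obj m),
    fim_map e (q + r) = fim_map e q + fim_map e r;
  fim_mapZ : forall m n (e : finj m n) (a : fiP K c m) (q : fim_obj m),
    fim_map e (a *: q) = fiP_map e a *: fim_map e q
}.

(* [M_n]_j is given as a subset of M_n; gfim_sum and gfim_direct say that     *)
(* M_n is the direct sum of the [M_n]_j.                                      *)

Record gradedFIModule (K : fieldType) (c : nat) := GradedFIModule {
  gfim_mod :> fiModule K c;
  gfim_comp : forall n, int -> gfim_mod n -> Prop;
  gfim_comp0 : forall n j, gfim_comp j (0 : gfim_mod n);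
  gfim_compB : forall n j (q r : gfim_mod n),
    gfim_comp j q -> gfim_comp j r -> gfim_comp j (q - r);
  gfim_compZ : forall n d j (a : fiP K c n) (q : gfim_mod n),
    a \is d.-homog -> gfim_comp j q -> gfim_comp (d%:Z + j) (a *: q);
  gfim_sum : forall n (q : gfim_mod n),
    exists (s : seq int) (y : int -> gfim_mod n),
      (forall j, gfim_comp j (y j)) /\ q = \sum_(j <- s) y j;
  gfim_direct : forall n (s : seq int) (y : int -> gfim_mod n),
    uniq s -> (forall j, gfim_comp j (y j)) -> \sum_(j <- s) y j = 0 ->
    forall j, j \in s -> y j = 0;
  gfim_comp_map : forall m n (e : finj m n) j (q : gfim_mod m),
    gfim_comp j q -> gfim_comp j (fim_map e q)
}.

Record is_fi_submodule (K : fieldType) (c : nat) (M : fiModule K c)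
    (N : forall n, M n -> Prop) : Prop := IsFISubmodule {
  fisub0 : forall n, N n 0;
  fisubD : forall n (q r : M n), N n q -> N n r -> N n (q + r);
  fisubZ : forall n (a : fiP K c n) (q : M n), N n q -> N n (a *: q);
  fisub_map : forall m n (e : finj m n) (q : M m), N m q -> N n (fim_map e q)
}.

Definition fi_generates (K : fieldType) (c : nat) (M : fiModule K c)
    (S : {n : nat & M n} -> Prop) : Prop :=
  forall N : (forall n, M n -> Prop), is_fi_submodule N ->
    (forall n (q : M n), S (existT _ n q) -> N n q) ->
    forall n (q : M n), N n q.

Definition fi_finitely_generated (K : fieldType) (c : nat) (M : fiModule K c)
    : Prop :=
  exists s : seq {n : nat & M n}, fi_generates (fun y => y \in s).

Definition fi_generated_nonneg (K : fieldType) (c : nat)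
    (M : gradedFIModule K c) : Prop :=
  exists S : {n : nat & M n} -> Prop,
    fi_generates S /\
    forall n (q : M n), S (existT _ n q) ->
      exists j : int, 0 <= j /\ gfim_comp j q.

(* V is a K-subspace of M_n of finite dimension d: it has a basis of d        *)
(* vectors.  The scalar k : K acts on M_n as the constant polynomial k%:MP.   *)
Definition has_dim (K : fieldType) (c : nat) (M : fiModule K c) (n : nat)
    (V : M n -> Prop) (d : nat) : Prop :=
  exists v : 'I_d -> M n,
    [/\ forall i, V (v i),
        forall k : 'I_d -> K,
          \sum_i ((k i)%:MP : fiP K c n) *: v i = 0 -> forall i, k i = 0
      & forall q, V q ->
          exists k : 'I_d -> K, q = \sum_i ((k i)%:MP : fiP K c n) *: v i].

Definition is_hilbert_function (K : fieldType) (c : nat)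
    (M : gradedFIModule K c) (h : nat -> int -> nat) : Prop :=
  forall n j, has_dim (@gfim_comp K c M n j) (h n j).

(* Z[s,t] is {poly {poly int}} with s the outer variable 'X and t the inner   *)
(* one, so that p`_n`_j is the coefficient of s^n t^j in p; an element of     *)
(* Z[[s,t]] is given by its coefficients, F n j being that of s^n t^j.        *)

Definition biseries := nat -> nat -> int.

Definition biseries_of_poly (p : {poly {poly int}}) : biseries :=
  fun n j => p`_n`_j.

Definition biseries_mul (F G : biseries) : biseries := fun n j =>
  \sum_(k < n.+1) \sum_(l < j.+1) F k l * G (n - k)%N (j - l)%N.

(* H = p / q in Z[[s,t]]; a power series over Z is invertible exactly when    *)
(* its constant term is.                                                      *)
Definition biseries_is_quotient (H : biseries) (p q : {poly {poly int}})
    : Prop :=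
  q`_0`_0 \is a GRing.unit /\
  forall n j, biseries_mul (biseries_of_poly q) H n j = biseries_of_poly p n j.

(* (1-t)^a * \prod_{j=1}^b [(1-t)^{c_j} - s f_j(t)] *)
Definition hilbert_denominator (a b : nat) (cs : 'I_b -> nat)
    (f : 'I_b -> {poly int}) : {poly {poly int}} :=
  ((1 - 'X) ^+ a)%:P *
  \prod_(j < b) (((1 - 'X) ^+ cs j)%:P - 'X * (f j)%:P).

(* Main.v *)
Require Import Defs.
From HB Require Import structures.
From mathcomp Require Import all_boot all_order all_algebra.
From mathcomp Require Import mpoly.
From mathcomp Require Import boolp ring zify.

Set Implicit Arguments.
Unset Strict Implicit.
Unset Printing Implicit Defensive.

Import Order.TTheory GRing.Theory Num.Theory.

(** Choose homogeneous generators [g_i] of [M], of width [d_i] and degree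
    [e_i >= 0].  Over the ground field, [M_n] is spanned by the terms
    [X^u M(p) g_i], where [p : [d_i] -> [n]] is injective and [X^u] is a monomial
    of [P_n].  Order the terms of each width totally, in such a way that
    multiplication by a monomial and transport along an increasing map are
    strictly monotone, and call a term standard if it is not a linear
    combination of smaller terms of its degree.  As in Gaussian elimination, the
    standard terms of width [n] and degree [j] form a basis of [[M_n]_j]
    ([has_dim_std_basis]).  If a product of a term, transported along an
    increasing map, is standard, then so is the term itself ([standard_act]), a
    relation for the latter being carried to one for the former.

    A term of width [n] is a word of length [n]: its [j]-th letter consists of the
    exponents of the variables [x_{1,j}, ..., x_{c,j}] and, if [j = p l], of the
    label [l].  Divisibility of terms becomes Higman's order on words
    ([emb_code]), so that the standard terms on a given generator are those words
    of a down-closed set in which every label occurs exactly once.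

    It remains to compute the generating series [H_S] of a down-closed set [S] of
    words ([rational_words]).  By Higman's lemma one may argue by induction on
    [S], which is assumed nonempty.  For a letter [a], let [S_a] be the set of the
    [w] such that [a w] lies in [S]; it is down-closed and contained in [S], and
    decreases when [a] grows.  Leaving labels aside,
      [H_S = 1 + s \sum_a t^|a| H_{S_a}],
    where the [a] with [S_a = S] form a down-closed set of vectors; unless empty,
    it has Hilbert series [f / (1 - t)^e] with [e <= c], [f.[1] > 0] and
    [f.[0] = 1] ([dickson_series]).  Moving its contribution to the left, one gets
      [((1 - t)^e - s f) H_S = (1 - t)^e (1 + s \sum_(a | S_a <> S) t^|a| H_{S_a})],
    and the series on the right are known by induction.  The sum over [a], although
    infinite, is no obstacle: when a coordinate of [a] grows, [S_a] decreases, hence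
    is eventually constant, and a geometric series contributes [1 / (1 - t)]
    ([mtsum_closed]).  A labelled first letter leaves one label less to place. *)

(** * Well-quasi-orders *)

Definition increasing (g : nat -> nat) := forall i j, i < j -> g i < g j.

(** Monotone subsequences, unlike single ascents, can be extracted for several
    relations one after the other; this is what products of orders require. *)
Definition perfect (A : Type) (le : rel A) := forall f : nat -> A,
  exists2 g, increasing g & forall i j, i < j -> le (f (g i)) (f (g j)).

Definition wqo (A : Type) (le : rel A) := forall f : nat -> A,
  exists i j, i < j /\ le (f i) (f j).

Definition downclosed (A : Type) (le : rel A) (T : pred A) :=
  forall x y, le x y -> T y -> T x.

Lemma increasingS (g : nat -> nat) :
  (forall i, g i < g i.+1) -> increasing g.
Proof.
move=> gS i j; elim: j => // j IH; rewrite ltnS leq_eqVlt => /orP[/eqP->//|/IH].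
by move/ltn_trans; apply.
Qed.

Lemma increasing_comp g h : increasing g -> increasing h -> increasing (g \o h).
Proof. by move=> gP hP i j /hP/gP. Qed.

Lemma increasing_mono g : increasing g -> {mono g : i j / i < j}.
Proof.
move=> gP i j; apply/idP/idP; last exact: gP.
by case: (ltngtP i j) => // [/gP|->]; lia.
Qed.

Lemma increasing_ge g : increasing g -> forall i, i <= g i.
Proof. by move=> gP; elim=> // i IH; apply: leq_ltn_trans IH (gP _ _ _). Qed.

(** Iterating a choice of a later index yields a subsequence; [Q] records what
    is required of consecutive indices. *)
Lemma subsequence (P : pred nat) (Q : rel nat) i0 :
    P i0 -> (forall i, P i -> exists j, [/\ i < j, P j & Q i j]) ->
  exists g, [/\ increasing g, forall i, P (g i) & forall i, Q (g i) (g i.+1)].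
Proof.
move=> P0 step.
have step' (i : {i | P i}) : exists j : {j | P j},
    sval i < sval j /\ Q (sval i) (sval j).
  by case: i => i Pi; have [j [ij Pj Qij]] := step i Pi; exists (exist _ j Pj).
have [nxt nxtP] := choice step'.
pose g n := iter n nxt (exist _ i0 P0).
exists (fun n => sval (g n)); split=> [|i|i].
- by apply: increasingS => i; case: (nxtP (g i)).
- exact: (svalP (g i)).
- by case: (nxtP (g i)).
Qed.


(** Minima of the tails of a sequence of naturals, taken at increasing indices,
    increase. *)
Lemma perfect_leq : perfect leq.
Proof.
move=> f; pose P i := `[< forall j, i <= j -> f i <= f j >].
have tail_min i : exists2 j, i < j & P j.
  have ex : exists m, `[< exists2 j, i < j & f j = m >].
    by exists (f i.+1); apply/asboolP; exists i.+1.
  have [m /asboolP[j ij fj] m_min] := ex_minnP ex.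
  exists j => //; apply/asboolP => k jk; rewrite fj; apply: m_min.
  by apply/asboolP; exists k => //; apply: leq_trans jk.
have [i0 _ P0] := tail_min 0.
have [|g [g_incr gP _]] := @subsequence P (fun _ _ => true) i0 P0.
  by move=> i _; have [j] := tail_min i; exists j.
exists g => // i j ij; have /asboolP := gP i; apply.
by apply: ltnW; apply: g_incr.
Qed.

(** Some value is taken infinitely often. *)
Lemma perfect_eq (L : finType) : perfect (@eq_op L).
Proof.
move=> f; have [l l_inf] : exists l, forall i, exists2 j, i < j & f j = l.
  apply: contrapT => /forallNP no_l.
  have bound l : exists i, forall j, i < j -> f j <> l.
    have /existsNP[i /forall2NP iP] := no_l l.
    by exists i => j ij; case: (iP j).
  have [b bP] := choice bound.
  pose m := (\max_(l : L) b l).+1.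
  by apply: (bP (f m) m) => //; rewrite ltnS (leq_bigmax (f m)).
have [i0 _ f0] := l_inf 0.
have [||g [g_incr gP _]] := @subsequence (fun i => f i == l) (fun _ _ => true) i0.
- exact/eqP.
- by move=> i _; have [j ij /eqP fj] := l_inf i; exists j.
by exists g => // i j _; rewrite (eqP (gP i)) (eqP (gP j)).
Qed.

Lemma perfect_preim (A B : Type) (le : rel B) (f : A -> B) :
  perfect le -> perfect (relpre f le).
Proof. by move=> leP s; have [g g_incr gP] := leP (f \o s); exists g. Qed.

Lemma perfectI (A : Type) (le1 le2 : rel A) :
  perfect le1 -> perfect le2 -> perfect (fun x y => le1 x y && le2 x y).
Proof.
move=> P1 P2 f; have [g g_incr gP] := P1 f; have [h h_incr hP] := P2 (f \o g).
exists (g \o h) => [|i j ij]; first exact: increasing_comp.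
by apply/andP; split; [apply/gP/h_incr | apply: hP].
Qed.

Lemma perfect_wqo_prod (A B : Type) (leA : rel A) (leB : rel B) :
  perfect leA -> wqo leB -> wqo (fun x y : A * B => leA x.1 y.1 && leB x.2 y.2).
Proof.
move=> PA PB f; have [g g_incr gP] := PA (fst \o f).
have [i [j [ij leij]]] := PB (snd \o f \o g).
by exists (g i), (g j); split; [apply: g_incr | rewrite leij andbT; apply: gP].
Qed.

(** A strict descent of down-closed sets could be witnessed by elements of the
    successive differences; these would form a sequence without ascent. *)
Lemma downclosed_stable (A : Type) (le : rel A) (T : nat -> pred A) :
    wqo le -> (forall k, downclosed le (T k)) ->
    (forall k x, T k.+1 x -> T k x) ->
  exists N, forall k, N <= k -> T k = T N.
Proof.
move=> leP T_down T_desc.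
have T_anti k l x : k <= l -> T l x -> T k x.
  by move/subnK <-; elim: (l - k) => // m IH /T_desc.
apply: contrapT => /forallNP unstable.
have drop N : exists k, exists x, [/\ N < k, T N x & ~~ T k x].
  apply: contrapT => no; apply: (unstable N) => k Nk.
  apply/funext => x; apply/idP/idP => [|TNx]; first exact: T_anti.
  apply: contrapT => /negP Tkx; apply: no; exists k, x; split=> //.
  by rewrite ltn_neqAle Nk andbT; apply: contraNneq Tkx => <-.
have [nxt /choice[x xP]] := choice drop.
have [|g [g_incr _ gP]] := @subsequence xpredT (fun i j => j == nxt i) 0 isT.
  by move=> i _; exists (nxt i); split=> //; case: (xP i).
have [i [j [ij leij]]] := leP (x \o g).
have [_ _ /negP[]] := xP (g i); rewrite -(eqP (gP i)).
apply: (T_down _ _ _ leij); have [_ Tj _] := xP (g j).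
apply: T_anti Tj; have := increasing_mono g_incr j i.+1; lia.
Qed.

(** Noetherian induction: a failure would propagate to smaller and smaller
    down-closed sets. *)
Lemma downclosed_ind (A : Type) (le : rel A) (P : pred A -> Prop) :
    wqo le ->
    (forall S, downclosed le S ->
      (forall T, downclosed le T -> subpred T S -> T <> S -> P T) -> P S) ->
  forall S, downclosed le S -> P S.
Proof.
move=> leP step S0 S0_down; apply: contrapT => notP0.
pose X := {S : pred A | downclosed le S /\ ~ P S}.
have smaller (S : X) : exists T : X, subpred (sval T) (sval S) /\ sval T <> sval S.
  case: S => S [S_down notP] /=; apply: contrapT => none.
  apply: notP; apply: step => // T T_down TS neqTS; apply: contrapT => notPT.
  by apply: none; exists (exist _ T (conj T_down notPT)).
have [nxt nxtP] := choice smaller.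
pose T n := iter n nxt (exist _ S0 (conj S0_down notP0)).
have [|k x|N NP] := downclosed_stable (T := fun n => sval (T n)) leP.
- by move=> k; case: (svalP (T k)).
- by case: (nxtP (T k)) => TS _; apply: TS.
- by case: (nxtP (T N)) => _; apply; apply: (NP N.+1).
Qed.

(** * Higman's lemma *)

(** Higman's order: letters are enlarged and new ones inserted. *)
Fixpoint emb (A : Type) (le : rel A) (u v : seq A) : bool :=
  if v is y :: v' then
    emb le u v' || (if u is x :: u' then le x y && emb le u' v' else true)
  else nilp u.

Section Higman.

Variables (A : Type) (le : rel A).

Lemma emb0 u : emb le [::] u.
Proof. by case: u => //= x u; rewrite orbT. Qed.

Lemma emb_skip y u v : emb le u v -> emb le u (y :: v).
Proof. by move=> /= ->. Qed.

Lemma emb_cons x y u v : le x y -> emb le u v -> emb le (x :: u) (y :: v).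
Proof. by move=> /= -> ->; rewrite orbT. Qed.

Lemma emb_refl : reflexive le -> reflexive (emb le).
Proof. by move=> le_refl; elim=> // x u IH; apply: emb_cons. Qed.

Lemma emb_trans : transitive le -> transitive (emb le).
Proof.
move=> le_trans v u w; elim: w u v => [|z w IH] u v.
  by case: v => // /[swap] _; case: u.
move=> uv /= /orP[vw|]; first by rewrite (IH _ _ uv vw).
case: v uv => [|y v]; first by case: u => //=; rewrite orbT.
move=> /= /orP[uv /andP[_ vw]|]; first by rewrite (IH _ _ uv vw).
case: u => [|x u]; first by rewrite orbT.
by case/andP=> xy uv /andP[yz vw]; rewrite (le_trans _ _ _ xy yz) (IH _ _ uv vw) orbT.
Qed.

Definition bad (f : nat -> seq A) := forall i j, i < j -> ~~ emb le (f i) (f j).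

(** Nash-Williams: were there a bad sequence, there would be one that is
    lexicographically minimal for the lengths of its terms; deleting first
    letters along a subsequence where these increase would beat it. *)
Lemma higman : perfect le -> wqo (emb le).
Proof.
move=> leP f0; apply: contrapT => none.
have bad0 : bad f0.
  by move=> i j ij; apply/negP => e; apply: none; exists i, j.
pose agree k (f h : nat -> seq A) := forall i, i < k -> f i = h i.
pose minimal k (h : nat -> seq A) := bad h /\
  forall h', bad h' -> agree k h' h -> size (h k) <= size (h' k).
have ext k f : bad f -> exists h, agree k h f /\ minimal k h.
  move=> bf.
  have ex : exists m,
      `[< exists h, [/\ bad h, agree k h f & size (h k) = m] >].
    by exists (size (f k)); apply/asboolP; exists f.
  have [m /asboolP[h [bh hf hk]] m_min] := ex_minnP ex.
  exists h; split=> //; split=> // h' bh' h'h; rewrite hk; apply: m_min.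
  by apply/asboolP; exists h'; split=> // i ik; rewrite h'h // hf.
pose X := {f | bad f}.
have ext' (kf : nat * X) : exists h : X,
    agree kf.1 (sval h) (sval kf.2) /\ minimal kf.1 (sval h).
  case: kf => k [f bf] /=; have [h [hf h_min]] := ext k f bf.
  by exists (exist _ h h_min.1).
have [nxt nxtP] := choice ext'.
pose F := fix F k : X := if k is k'.+1 then nxt (k, F k') else nxt (0, exist _ f0 bad0).
have FS k l : k <= l -> agree k.+1 (sval (F l)) (sval (F k)).
  move/subnK <-; elim: (l - k) => // m IH i ik.
  have [/= agr _] := nxtP ((m + k).+1, F (m + k)).
  rewrite agr ?IH //; lia.
have Fmin k : minimal k (sval (F k)).
  by case: k => [|k] /=; [case: (nxtP (0, exist _ f0 bad0))
    | case: (nxtP (k.+1, F k))].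
pose w k := sval (F k) k.
have wE k l : k <= l -> w k = sval (F l) k by move=> kl; rewrite /w (FS k l).
have bad_w : bad w.
  by move=> i j ij; rewrite (wE i j) ?(ltnW ij) //; apply: (svalP (F j)).
have w_cons k : exists x, exists u, w k = x :: u.
  have := bad_w k k.+1 (ltnSn k).
  by case: (w k) => [|x u]; [rewrite emb0 | exists x, u].
have [x /choice[u wxu]] := choice w_cons.
have [g g_incr gP] := leP x.
(* The sequence [w 0, ..., w k0.-1, u (g 0), u (g 1), ...] is bad as well: an ascent
   among its later terms extends to [w], the first letters being increasing. *)
pose k0 := g 0.
pose h n := if n < k0 then w n else u (g (n - k0)).
have emb_u k : forall v, emb le v (u k) -> emb le v (w k).
  by move=> v vu; rewrite wxu; apply: emb_skip.
have bad_h : bad h.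
  move=> i j ij; rewrite /h; case: ltnP => ik; case: ltnP => jk; first exact: bad_w.
  - apply: contra (@emb_u _ _) _; apply: bad_w; apply: leq_trans ik _.
    by case: (j - k0) (g_incr 0 (j - k0)) => // m /(_ isT) /ltnW.
  - by lia.
  - have ijg : i - k0 < j - k0 by lia.
    apply: contra (bad_w _ _ (g_incr _ _ ijg)).
    by rewrite !wxu => /(emb_cons (gP _ _ ijg)).
have [_ /(_ h bad_h)] := Fmin k0.
rewrite -/(w k0) wxu /h ltnn subnn /= -/k0 => /(_ _)/wrap[|]; last by rewrite ltnn.
by move=> i ik; rewrite ik (wE i k0) // ltnW.
Qed.

End Higman.

(** * Vectors of naturals *)

(** Only the first [r] entries count, and missing ones are zero: thus this is a
    preorder on all sequences, whatever their lengths. *)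
Fixpoint vle r (a b : seq nat) : bool :=
  if r is r'.+1 then (head 0 a <= head 0 b) && vle r' (behead a) (behead b)
  else true.

Lemma vle_refl r : reflexive (vle r).
Proof. by elim: r => //= r IH a; rewrite leqnn IH. Qed.

Lemma vle_trans r : transitive (vle r).
Proof.
elim: r => //= r IH b a c /andP[ab abr] /andP[bc bcr].
by rewrite (leq_trans ab bc) (IH _ _ _ abr bcr).
Qed.

Lemma vleP r a b :
  reflect (forall i, i < r -> nth 0 a i <= nth 0 b i) (vle r a b).
Proof.
elim: r a b => [|r IH] a b /=; first by apply: ReflectT.
apply: (iffP andP) => [[ab /IH abr] [|i]|ab]; rewrite -?nth0 //.
  by rewrite ltnS -!nth_behead; apply: abr.
by split; [apply: ab | apply/IH => i ir; rewrite !nth_behead; apply: ab].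
Qed.

Lemma perfect_vle r : perfect (vle r).
Proof.
elim: r => [|r IH]; first by move=> f; exists id.
by apply: perfectI; [apply: (perfect_preim (head 0)) perfect_leq
  | apply: (perfect_preim behead) IH].
Qed.

Local Open Scope ring_scope.

(** * Formal power series *)

(** Series in two variables are series in [s] whose coefficients are series in
    [t]; unfolding this type twice gives [biseries]. *)
Definition fps (R : comNzRingType) := nat -> R.

Section Fps.

Variable R : comNzRingType.
Implicit Types F G H : fps R.

HB.instance Definition _ := gen_eqMixin (fps R).
HB.instance Definition _ := gen_choiceMixin (fps R).

Lemma fpsP F G : (forall n, F n = G n) -> F = G.
Proof. by move=> FG; apply/funext. Qed.

Definition fps_zero : fps R := fun _ => 0.
Definition fps_opp F : fps R := fun n => - F n.
Definition fps_add F G : fps R := fun n => F n + G n.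
Definition fps_one : fps R := fun n => (n == 0%N)%:R.
Definition fps_mul F G : fps R := fun n => \sum_(k < n.+1) F k * G (n - k)%N.

Fact fps_addA : associative fps_add.
Proof. by move=> F G H; apply: fpsP => n; rewrite /fps_add addrA. Qed.
Fact fps_addC : commutative fps_add.
Proof. by move=> F G; apply: fpsP => n; rewrite /fps_add addrC. Qed.
Fact fps_add0 : left_id fps_zero fps_add.
Proof. by move=> F; apply: fpsP => n; rewrite /fps_add add0r. Qed.
Fact fps_addN : left_inverse fps_zero fps_opp fps_add.
Proof. by move=> F; apply: fpsP => n; rewrite /fps_add /fps_opp addNr. Qed.

HB.instance Definition _ :=
  GRing.isZmodule.Build (fps R) fps_addA fps_addC fps_add0 fps_addN.

(* Up to any given order products of series are products of polynomials, whence
   the ring laws. *)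
Let trunc N F : {poly R} := \poly_(i < N) F i.

Let truncE N F n : (n < N)%N -> (trunc N F)`_n = F n.
Proof. by move=> nN; rewrite coef_poly nN. Qed.

Let trunc_mul N F G n : (n < N)%N -> (trunc N F * trunc N G)`_n = fps_mul F G n.
Proof.
move=> nN; rewrite coefM; apply: eq_bigr => i _.
by rewrite !truncE //; have := ltn_ord i; lia.
Qed.

Fact fps_mulC : commutative fps_mul.
Proof.
by move=> F G; apply: fpsP => n; rewrite -!(@trunc_mul n.+1) // mulrC.
Qed.

Fact fps_mulA : associative fps_mul.
Proof.
move=> F G H; apply: fpsP => n.
transitivity ((trunc n.+1 F * (trunc n.+1 G * trunc n.+1 H))`_n).
  rewrite coefM; apply: eq_bigr => i _.
  by rewrite truncE // trunc_mul // ltnS leq_subr.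
rewrite mulrA coefM; apply: eq_bigr => i _.
by rewrite truncE ?ltnS ?leq_subr // trunc_mul.
Qed.

Fact fps_mul1 : left_id fps_one fps_mul.
Proof.
move=> F; apply: fpsP => n; rewrite /fps_mul big_ord_recl subn0 mul1r big1 ?addr0 //.
by move=> i _; rewrite /fps_one /= mul0r.
Qed.

Fact fps_mulDl : left_distributive fps_mul fps_add.
Proof.
move=> F G H; apply: fpsP => n; rewrite /fps_mul /fps_add -big_split.
by apply: eq_bigr => i _; rewrite mulrDl.
Qed.

Fact fps_oneN0 : fps_one != fps_zero.
Proof. by apply/eqP => /(congr1 (fun F => F 0%N)) /eqP; rewrite oner_eq0. Qed.

HB.instance Definition _ := GRing.Zmodule_isComNzRing.Build (fps R)
  fps_mulA fps_mulC fps_mul1 fps_mulDl fps_oneN0.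

Lemma fpsD F G n : (F + G) n = F n + G n. Proof. by []. Qed.
Lemma fpsN F n : (- F) n = - F n. Proof. by []. Qed.
Lemma fpsM F G n : (F * G) n = \sum_(k < n.+1) F k * G (n - k)%N.
Proof. by []. Qed.
Lemma fps0 n : (0 : fps R) n = 0. Proof. by []. Qed.

Lemma fps_sum (I : Type) (r : seq I) (P : pred I) (F : I -> fps R) n :
  (\sum_(i <- r | P i) F i) n = \sum_(i <- r | P i) F i n.
Proof. exact: (big_morph (fun F : fps R => F n)). Qed.

Definition fps_of_poly (p : {poly R}) : fps R := fun n => p`_n.

Fact fps_of_poly_additive : zmod_morphism fps_of_poly.
Proof. by move=> p q; apply: fpsP => n; rewrite fpsD fpsN /fps_of_poly coefB. Qed.
Fact fps_of_poly_multiplicative : monoid_morphism fps_of_poly.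
Proof.
split=> [|p q]; apply: fpsP => n; first by rewrite /fps_of_poly coef1.
by rewrite /fps_of_poly coefM.
Qed.
HB.instance Definition _ :=
  GRing.isZmodMorphism.Build {poly R} (fps R) fps_of_poly fps_of_poly_additive.
HB.instance Definition _ :=
  GRing.isMonoidMorphism.Build {poly R} (fps R) fps_of_poly
    fps_of_poly_multiplicative.

Lemma fps_mulX F n : (fps_of_poly 'X * F) n = if n is m.+1 then F m else 0.
Proof.
rewrite fpsM; case: n => [|n]; first by rewrite big_ord1 /fps_of_poly coefX mul0r.
rewrite 2!big_ord_recl /fps_of_poly !coefX /= mul0r add0r mul1r subSS subn0.
by rewrite big1 ?addr0 // => i _; rewrite coefX mul0r.
Qed.

Lemma fps_mulC_coef (a : R) F n : (fps_of_poly a%:P * F) n = a * F n.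
Proof.
rewrite fpsM big_ord_recl /fps_of_poly coefC /= subn0 big1 ?addr0 //.
by move=> i _; rewrite coefC mul0r.
Qed.

End Fps.

(** * Series in two variables *)

Notation ser2 := (fps (fps int)).

Definition ser_of_poly2 (p : {poly {poly int}}) : ser2 :=
  fps_of_poly (map_poly (@fps_of_poly int) p).

HB.instance Definition _ := GRing.RMorphism.copy ser_of_poly2
  (@fps_of_poly (fps int) \o map_poly (@fps_of_poly int)).

Lemma ser_of_poly2E p n j : ser_of_poly2 p n j = p`_n`_j.
Proof.
rewrite -[LHS]/((map_poly (@fps_of_poly int) p)`_n j).
by rewrite (coef_map (@fps_of_poly int)).
Qed.

Notation s_ := (ser_of_poly2 'X).
Notation t_ := (ser_of_poly2 'X%:P).

Lemma ser_mul_s F n : (s_ * F) n = if n is m.+1 then F m else 0.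
Proof. by rewrite /ser_of_poly2 map_polyX fps_mulX. Qed.

Lemma ser_mul_t F n j : (t_ * F) n j = if j is i.+1 then F n i else 0.
Proof. by rewrite /ser_of_poly2 map_polyC fps_mulC_coef fps_mulX. Qed.

Lemma ser2P (F G : ser2) : (forall n j, F n j = G n j) -> F = G.
Proof. by move=> FG; apply: fpsP => n; apply: fpsP. Qed.

Lemma biseries_mulE (F G : ser2) n j : biseries_mul F G n j = (F * G) n j.
Proof. by rewrite fpsM fps_sum; apply: eq_bigr. Qed.

(** [tsum G] is the sum of the [t ^ k * G k]. *)
Definition tsum (G : nat -> ser2) : ser2 :=
  fun n j => \sum_(k < j.+1) G k n (j - k)%N.

Lemma tsumS G : tsum G = G 0%N + t_ * tsum (fun k => G k.+1).
Proof.
apply: ser2P => n [|j]; rewrite !fpsD ser_mul_t /tsum; first by rewrite big_ord1 addr0.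
by rewrite big_ord_recl subn0.
Qed.

Lemma tsum_const F : (1 - t_) * tsum (fun=> F) = F.
Proof. by rewrite mulrBl mul1r {1}tsumS addrK. Qed.

Lemma tsumD G1 G2 : tsum (fun k => G1 k + G2 k) = tsum G1 + tsum G2.
Proof. by apply: ser2P => n j; rewrite /tsum !fpsD -big_split. Qed.

(** The difference of the two sides is a multiple of every power of [t]. *)
Lemma tsumM G F : tsum (fun k => G k * F) = tsum G * F.
Proof.
apply/eqP; rewrite -subr_eq0; apply/eqP/ser2P => n j; rewrite !fps0.
elim: j G => [|j IH] G; rewrite [tsum _]tsumS [tsum G]tsumS mulrDl opprD.
all: rewrite addrACA subrr add0r -mulrA -mulrBr ser_mul_t //.
Qed.

Lemma mul1t_inj F : (1 - t_) * F = 0 -> F = 0.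
Proof.
move=> F0; have <- : (1 - t_) * tsum (fun=> 1) * F = F by rewrite tsum_const mul1r.
by rewrite mulrAC F0 mul0r.
Qed.

(** The sum of the [t ^ |a| * G a] over the vectors [a] of length [r]. *)
Fixpoint mtsum r (G : seq nat -> ser2) : ser2 :=
  if r is r'.+1 then tsum (fun k => mtsum r' (fun a => G (k :: a)))
  else G [::].

Lemma eq_mtsum r G1 G2 : (forall a, G1 a = G2 a) -> mtsum r G1 = mtsum r G2.
Proof. by move=> /funext->. Qed.

Lemma mtsumD r G1 G2 : mtsum r (fun a => G1 a + G2 a) = mtsum r G1 + mtsum r G2.
Proof.
elim: r G1 G2 => //= r IH G1 G2; rewrite -tsumD; congr tsum; apply/funext => k.
exact: IH.
Qed.

Lemma mtsumM r G F : mtsum r (fun a => G a * F) = mtsum r G * F.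
Proof.
elim: r G => //= r IH G; rewrite -tsumM; congr tsum; apply/funext => k; exact: IH.
Qed.

Lemma mtsum0 r : mtsum r (fun=> 0) = 0.
Proof. by elim: r => //= r ->; apply: ser2P => n j; rewrite /tsum big1. Qed.

Lemma mtsum_coef00 r G : mtsum r G 0 0 = G (nseq r 0) 0 0.
Proof. by elim: r G => //= r IH G; rewrite /tsum big_ord1 IH. Qed.

(** Dickson's lemma makes the sum over all vectors accessible to finitely many
    additions, shifts and divisions by [1 - t]: as a coordinate grows, the
    slices of a down-closed set decrease, hence stabilize. *)
Section SumOverVectors.

Variable C : nat -> ser2 -> Prop.
Hypothesis C_mono : forall r F, C r F -> C r.+1 F.
Hypothesis C_add : forall r F G, C r F -> C r G -> C r (F + G).
Hypothesis C_mult : forall r F, C r F -> C r (t_ * F).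
Hypothesis C_div : forall r F, C r ((1 - t_) * F) -> C r.+1 F.

Lemma tsum_eventually_const r (G : nat -> ser2) N :
    (forall k, C r (G k)) -> (forall k, (N <= k)%N -> G k = G N) ->
  C r.+1 (tsum G).
Proof.
elim: N G => [|N IH] G CG stable.
  apply: C_div; have -> : G = (fun=> G 0%N) by apply/funext => k; apply: stable.
  by rewrite tsum_const.
rewrite tsumS; apply: C_add; first exact: C_mono.
apply/C_mult/IH => // k Nk; exact: stable.
Qed.

Lemma mtsum_closed (W : Type) (le : rel W) (G : pred W -> ser2) :
    reflexive le -> wqo le ->
  forall r (T : pred (seq nat * W)),
    downclosed (fun x y => vle r x.1 y.1 && le x.2 y.2) T ->
    (forall a, C 0 (G (fun w => T (a, w)))) ->
  C r (mtsum r (fun a => G (fun w => T (a, w)))).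
Proof.
move=> le_refl leP; elim=> [|r IH] T T_down CT; first exact: CT.
pose T' k : pred (seq nat * W) := fun x => T (k :: x.1, x.2).
have T'_down k : downclosed (fun x y => vle r x.1 y.1 && le x.2 y.2) (T' k).
  by move=> x y xy; apply: T_down; rewrite /= leqnn.
have [k x|N stable] := downclosed_stable (perfect_wqo_prod (perfect_vle r) leP) T'_down.
  by apply: T_down; rewrite /= leqnSn vle_refl le_refl.
apply: (@tsum_eventually_const _ _ N) => [k|k Nk].
  by apply: (IH (T' k)) => // a; apply: (CT (k :: a)).
by apply: eq_mtsum => a; congr G; apply/funext => w;
  apply: (congr1 (fun U => U (a, w)) (stable k Nk)).
Qed.

End SumOverVectors.

(** * Rational series *)

(** Positivity of the numerators at 1 keeps this class closed under addition: the
    leading terms at the pole cannot cancel.  Zero is the series of the empty set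
    of vectors. *)
Definition pole_at1 r (F : ser2) := F = 0 \/
  exists e (f : {poly int}),
    [/\ (e <= r)%N, 0 < f.[1] & (1 - t_) ^+ e * F = ser_of_poly2 f%:P].

Lemma ser1Bt : ser_of_poly2 (1 - 'X)%:P = 1 - t_.
Proof. by rewrite polyCB rmorphB polyC1 rmorph1. Qed.

Lemma ser1BtX e : ser_of_poly2 ((1 - 'X) ^+ e)%:P = (1 - t_) ^+ e.
Proof. by rewrite polyC_exp rmorphXn /= ser1Bt. Qed.

Lemma pole_at1_mono r F : pole_at1 r F -> pole_at1 r.+1 F.
Proof.
by case=> [->|[e [f [er f1 eqf]]]]; [left | right; exists e, f; split=> //; lia].
Qed.

Lemma pole_at1_add r F G : pole_at1 r F -> pole_at1 r G -> pole_at1 r (F + G).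
Proof.
have add_le e1 e2 (f1 f2 : {poly int}) F' G' : (e1 <= e2)%N -> (e2 <= r)%N ->
    0 < f1.[1] -> 0 < f2.[1] ->
    (1 - t_) ^+ e1 * F' = ser_of_poly2 f1%:P ->
    (1 - t_) ^+ e2 * G' = ser_of_poly2 f2%:P -> pole_at1 r (F' + G').
  move=> e12 e2r f1P f2P E1 E2; right.
  exists e2, ((1 - 'X) ^+ (e2 - e1) * f1 + f2); split=> //.
    rewrite hornerD hornerM horner_exp !hornerE; case: (e2 - e1)%N => [|k].
      by rewrite expr0 mul1r addr_gt0.
    by rewrite subrr expr0n /= mul0r add0r.
  rewrite polyCD rmorphD polyCM rmorphM /= ser1BtX -E1 -E2 mulrDr mulrA -exprD.
  by rewrite subnK.
case=> [->|[e1 [f1 [e1r f1P E1]]]]; first by rewrite add0r.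
case=> [->|[e2 [f2 [e2r f2P E2]]]]; first by rewrite addr0; right; exists e1, f1.
case: (leqP e1 e2) => [|/ltnW] e12; first exact: add_le e12 _ _ _ E1 E2.
by rewrite addrC; apply: add_le e12 _ _ _ E2 E1.
Qed.

Lemma pole_at1_mult r F : pole_at1 r F -> pole_at1 r (t_ * F).
Proof.
case=> [->|[e [f [er f1 eqf]]]]; first by rewrite mulr0; left.
right; exists e, ('X * f); rewrite hornerM hornerX mul1r; split=> //.
by rewrite mulrCA eqf polyCM rmorphM.
Qed.

Lemma pole_at1_div r F : pole_at1 r ((1 - t_) * F) -> pole_at1 r.+1 F.
Proof.
case=> [/mul1t_inj->|[e [f [er f1 eqf]]]]; first by left.
by right; exists e.+1, f; rewrite exprSr -mulrA.
Qed.

(** Besides the closure properties of [pole_at1]: the numerator takes the value 1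
    at 0, for the zero vector is the only one of degree zero and belongs to every
    nonempty down-closed set. *)
Lemma dickson_series r (D : pred (seq nat)) : downclosed (vle r) D ->
    let F := mtsum r (fun a => (D a)%:R) in
  F = 0 \/ exists e (f : {poly int}),
    [/\ (e <= r)%N, 0 < f.[1], f.[0] = 1 & (1 - t_) ^+ e * F = ser_of_poly2 f%:P].
Proof.
move=> D_down F.
have : pole_at1 r F.
  pose T (x : seq nat * unit) := D x.1.
  apply: (@mtsum_closed _ pole_at1_mono pole_at1_add pole_at1_mult pole_at1_div unit
    (fun _ _ => true) (fun U => (U tt)%:R) _ _ r T) => //.
  - by move=> f; exists 0%N, 1%N.
  - by move=> x y /andP[xy _]; apply: D_down.
  move=> a; case: (T _); last by left.
  right; exists 0%N, 1; split; [by [] | by rewrite hornerC |].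
  by rewrite expr0 mul1r polyC1 (rmorph1 ser_of_poly2).
case=> [->|[e [f [er f1 eqf]]]]; first by left.
have [D0|D0] := boolP (D (nseq r 0%N)); last first.
  left; rewrite /F -(mtsum0 r); apply: eq_mtsum => a.
  case Da: (D a) => //; case/negP: D0; apply: D_down Da.
  by apply/vleP => i ir; rewrite nth_nseq ir.
right; exists e, f; split=> //.
have := congr1 (fun F : ser2 => F 0%N 0%N) eqf.
rewrite ser_of_poly2E coefC /= -horner_coef0 => <-.
rewrite -ser1BtX fpsM big_ord1 fpsM big_ord1 ser_of_poly2E coefC /=.
rewrite -horner_coef0 horner_exp !hornerE expr1n mul1r.
by rewrite /F mtsum_coef00 D0.
Qed.

Section Rational.

Variable c : nat.

Definition factor_ok (x : nat * {poly int}) :=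
  [/\ (x.1 <= c)%N, 0 < x.2.[1] & x.2.[0] = 1].

Definition factor (x : nat * {poly int}) : {poly {poly int}} :=
  ((1 - 'X) ^+ x.1)%:P - 'X * x.2%:P.

Definition denominator a (l : seq (nat * {poly int})) : {poly {poly int}} :=
  ((1 - 'X) ^+ a)%:P * \prod_(x <- l) factor x.

Definition rational (F : ser2) := exists a l g,
  (forall x, x \in l -> factor_ok x) /\
  ser_of_poly2 (denominator a l) * F = ser_of_poly2 g.

Lemma rational_poly g : rational (ser_of_poly2 g).
Proof.
by exists 0%N, [::], g; rewrite /denominator big_nil expr0 mul1r rmorph1 mul1r.
Qed.

Lemma rational0 : rational 0.
Proof. by rewrite -(rmorph0 ser_of_poly2); apply: rational_poly. Qed.

Lemma rational_add F G : rational F -> rational G -> rational (F + G).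
Proof.
move=> [a1 [l1 [g1 [ok1 E1]]]] [a2 [l2 [g2 [ok2 E2]]]].
exists (a1 + a2)%N, (l1 ++ l2), (denominator a2 l2 * g1 + denominator a1 l1 * g2).
split=> [x|]; first by rewrite mem_cat => /orP[/ok1|/ok2].
have -> : denominator (a1 + a2) (l1 ++ l2) = denominator a1 l1 * denominator a2 l2.
  by rewrite /denominator exprD polyCM big_cat /= mulrACA.
by move: (denominator a1 l1) (denominator a2 l2) E1 E2 => d1 d2 E1 E2;
  rewrite rmorphD !rmorphM /= -E1 -E2; ring.
Qed.

Lemma rational_sum (I : Type) (r : seq I) (F : I -> ser2) :
  (forall i, rational (F i)) -> rational (\sum_(i <- r) F i).
Proof. by move=> ratF; apply: big_ind; [apply: rational0 | apply: rational_add |]. Qed.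

Lemma rational_mul g F : rational F -> rational (ser_of_poly2 g * F).
Proof.
move=> [a [l [h [ok E]]]]; exists a, l, (g * h); split=> //.
by rewrite mulrCA E rmorphM.
Qed.

Lemma rational_div1t F : rational ((1 - t_) * F) -> rational F.
Proof.
move=> [a [l [h [ok E]]]]; exists a.+1, l, h; split=> //; rewrite -E.
by rewrite /denominator exprS polyCM !rmorphM /= ser1Bt; ring.
Qed.

Lemma rational_div_factor x F : factor_ok x ->
  rational (ser_of_poly2 (factor x) * F) -> rational F.
Proof.
move=> okx [a [l [h [ok E]]]]; exists a, (x :: l), h; split.
  by move=> y; rewrite inE => /predU1P[->//|/ok].
by rewrite -E /denominator big_cons !rmorphM /=; ring.
Qed.

Lemma rational_mtsum (W : Type) (le : rel W) (G : pred W -> ser2) :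
    reflexive le -> wqo le ->
  forall r (T : pred (seq nat * W)),
    downclosed (fun x y => vle r x.1 y.1 && le x.2 y.2) T ->
    (forall a, rational (G (fun w => T (a, w)))) ->
  rational (mtsum r (fun a => G (fun w => T (a, w)))).
Proof.
move=> le_refl leP r T T_down ratT.
apply: (@mtsum_closed (fun _ => rational) _ _ _ _ _ le G le_refl leP r T) => //.
- by move=> _; apply: rational_add.
- by move=> _ F; apply: rational_mul.
- by move=> _; apply: rational_div1t.
Qed.

End Rational.

(** * Counting words *)

Fixpoint vecs (r j : nat) : seq (seq nat) :=
  if r is r'.+1 then [seq k :: a | k <- iota 0 j.+1, a <- vecs r' (j - k)%N]
  else [:: [::]].

Lemma vecsS r j :
  vecs r.+1 j = [seq k :: a | k <- iota 0 j.+1, a <- vecs r (j - k)%N].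
Proof. by []. Qed.

Lemma mem_vecs r j a : (a \in vecs r j) = (size a == r) && (sumn a <= j)%N.
Proof.
elim: r j a => [|r IH] j a; first by case: a => [|x a].
rewrite vecsS; apply/allpairsPdep/idP => [[k [b []]]|].
  rewrite IH mem_iota => kj /andP[/eqP<- bj] ->; rewrite /= eqxx /=; lia.
case: a => // k a /andP[ar aj]; exists k, a; rewrite IH mem_iota.
by move: ar aj => /= ar aj; split=> //; lia.
Qed.

Lemma vecs_uniq r j : uniq (vecs r j).
Proof.
elim: r j => // r IH j; rewrite vecsS; apply: allpairs_uniq_dep; rewrite ?iota_uniq //.
by move=> [k a] [l b] _ _ /= [-> ->].
Qed.

Lemma mtsum_coef r G n j :
  mtsum r G n j = \sum_(a <- vecs r j) G a n (j - sumn a)%N.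
Proof.
elim: r G j => [|r IH] G j; first by rewrite big_seq1 subn0.
rewrite vecsS big_allpairs_dep -[iota 0 j.+1]/(index_iota 0 j.+1) big_mkord /=.
apply: eq_bigr => k _; rewrite IH; apply: eq_bigr => a _.
by rewrite subnDA.
Qed.

Section Words.

Variables (L : finType) (c : nat).

(** One column of a term: the label of the element sent there by the map, if any,
    and the exponents of the [c] variables of the column. *)
Definition letter := (option L * seq nat)%type.

Implicit Types (S : pred (seq letter)) (w : seq letter) (A : {set L}).

Definition lle (x y : letter) := (x.1 == y.1) && vle c x.2 y.2.

Lemma lle_refl : reflexive lle.
Proof. by move=> x; rewrite /lle eqxx vle_refl. Qed.

Lemma lle_trans : transitive lle.
Proof.
move=> y x z /andP[/eqP xy1 xy] /andP[/eqP yz1 yz].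
by rewrite /lle xy1 yz1 eqxx (vle_trans xy yz).
Qed.

Lemma wqo_words : wqo (emb lle).
Proof.
apply: higman; apply: perfectI.
  exact: (perfect_preim fst) (@perfect_eq _).
exact: (perfect_preim snd) (@perfect_vle c).
Qed.

(** Enumerated by first letters, for the sake of the functional equation below;
    [mem_words] gives the direct description. *)
Fixpoint words (n : nat) A (j : nat) : seq (seq letter) :=
  if n is n'.+1 then
    [seq (None, a) :: w | a <- vecs c j, w <- words n' A (j - sumn a)%N] ++
    flatten [seq [seq (Some l, a) :: w | a <- vecs c j,
                    w <- words n' (A :\ l) (j - sumn a)%N] | l <- enum A]
  else if (A == set0) && (j == 0%N) then [:: [::]] else [::].

Definition labels w := pmap fst w.

Definition is_word n A j w :=
  [&& size w == n, all (fun x => size x.2 == c) w,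
      sumn [seq sumn x.2 | x <- w] == j, uniq (labels w)
    & A == [set l in labels w]].

Lemma mem_words n A j w : (w \in words n A j) = is_word n A j w.
Proof.
rewrite /is_word; elim: n A j w => [|n IH] A j w /=.
  case: w => [|x w]; last by case: ifP.
  have -> : [set l in [::]] = set0 :> {set L} by apply/setP => l; rewrite !inE.
  by case: (A == set0); case: j.
rewrite mem_cat; apply/orP/idP => [[]|].
- case/allpairsPdep=> a [v [+ + ->]]; rewrite mem_vecs IH => /andP[sa aj].
  case/and5P => /eqP<- vc /eqP vj uv AE; rewrite /= eqxx sa vc uv AE vj /=; lia.
- case/flatten_mapP => l; rewrite mem_enum => lA.
  case/allpairsPdep=> a [v [+ + ->]]; rewrite mem_vecs IH => /andP[sa aj].
  case/and5P => /eqP<- vc /eqP vj uv /eqP AE; rewrite /= eqxx sa vc uv vj /=.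
  have lv : l \notin labels v.
    by have := setD11 l A; rewrite AE inE => ->.
  rewrite lv /=; apply/andP; split; first lia.
  by rewrite -(setD1K lA) AE set_cons.
case: w => // -[[l|] a] v /= /and5P[sv /andP[sa vc] jE].
- case/andP=> lv uv /eqP AE; right; apply/flatten_mapP; exists l.
    by rewrite mem_enum AE inE mem_head.
  apply/allpairsPdep; exists a, v; split=> //; first by rewrite mem_vecs sa; lia.
  rewrite IH vc uv; apply/and5P; split=> //; first by lia.
  rewrite AE set_cons setU1K ?inE //.
- move=> uv AE; left; apply/allpairsPdep; exists a, v; split=> //.
    by rewrite mem_vecs sa; lia.
  by rewrite IH vc uv AE; apply/and5P; split=> //; lia.
Qed.

Lemma words_uniq n A j : uniq (words n A j).
Proof.
elim: n A j => [|n IH] A j /=; first by case: ifP.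
rewrite cat_uniq; apply/and3P; split.
- apply: allpairs_uniq_dep => [|a _|[a v] [b w] _ _ /= [-> ->]] //; exact: vecs_uniq.
- apply/hasPn => w /flatten_mapP[l _ /allpairsPdep[a [v [_ _ ->]]]].
  by apply/allpairsPdep => -[b [u [_ _]]].
- elim: (enum A) (enum_uniq A) => //= l s IHs /andP[ls us].
  rewrite cat_uniq IHs // andbT; apply/andP; split.
    apply: allpairs_uniq_dep => [|a _|[a v] [b w] _ _ /= [-> ->]] //; exact: vecs_uniq.
  apply/hasPn => w /flatten_mapP[l' l's /allpairsPdep[a [v [_ _ ->]]]].
  by apply/allpairsPdep => -[b [u [_ _ [ll' _ _]]]]; move: l's; rewrite ll' (negbTE ls).
Qed.

Definition word_series A S : ser2 := fun n j => (count S (words n A j))%:Z.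

Definition quot S x : pred (seq letter) := fun w => S (x :: w).

Lemma count_cons_allpairs (S : pred (seq letter)) (x : seq nat -> letter) s B :
  (count S [seq x a :: w | a <- s, w <- B a])%:Z =
  \sum_(a <- s) (count (quot S (x a)) (B a))%:Z :> int.
Proof.
elim: s => [|a s IH]; first by rewrite big_nil.
by rewrite big_cons /= count_cat PoszD IH count_map.
Qed.

Lemma word_seriesE A S : word_series A S =
  ser_of_poly2 ((A == set0) && S [::])%:R +
  s_ * (mtsum c (fun a => word_series A (quot S (None, a))) +
        \sum_(l <- enum A)
          mtsum c (fun a => word_series (A :\ l) (quot S (Some l, a)))).
Proof.
apply: ser2P => n j; rewrite 2!fpsD ser_mul_s ser_of_poly2E /word_series.
have coefb (b : bool) m :
    (b%:R : {poly {poly int}})`_m`_j = [&& b, m == 0%N & j == 0%N]%:R.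
  case: b; rewrite ?mulr0n ?coef0 // mulr1n coef1.
  by case: (m == 0%N); rewrite ?mulr0n ?coef0 // mulr1n coef1.
rewrite coefb; case: n => [|n] /=.
  by rewrite addr0; case: (A == set0); case: (j == 0%N) => /=; case: (S [::]).
rewrite andbF mulr0n add0r 2!fpsD 2!fps_sum mtsum_coef.
rewrite count_cat PoszD count_cons_allpairs.
congr (_ + _); elim: (enum A) => [|l s IH]; first by rewrite big_nil.
by rewrite big_cons /= count_cat PoszD IH count_cons_allpairs mtsum_coef.
Qed.

Lemma quot_down S x : downclosed (emb lle) S -> downclosed (emb lle) (quot S x).
Proof. by move=> S_down v w vw; apply: S_down; apply: emb_cons (lle_refl x) vw. Qed.

Lemma quot_sub S x : downclosed (emb lle) S -> subpred (quot S x) S.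
Proof. by move=> S_down w; apply: S_down; apply/emb_skip/emb_refl/lle_refl. Qed.

Lemma quot_pair_down S l : downclosed (emb lle) S ->
  downclosed (fun x y : seq nat * seq letter => vle c x.1 y.1 && emb lle x.2 y.2)
    (fun x => S ((l, x.1) :: x.2)).
Proof.
move=> S_down x y /andP[xy1 xy2]; apply: S_down; apply: emb_cons xy2.
by rewrite /lle eqxx.
Qed.

(** In the recursion for [S] the quotients equal to [S] are those by a
    down-closed set of letters; their contribution is moved to the left-hand
    side, where it produces the factor [(1 - t) ^ e - s f].  All the other
    quotients are smaller than [S], or bear fewer labels. *)
Theorem rational_words A S :
  downclosed (emb lle) S -> rational c (word_series A S).
Proof.
have [k leAk] := ubnP #|A|; elim: k A S leAk => // k IHk A S0 leAk.
move: S0; apply: (downclosed_ind wqo_words) => S S_down IHS.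
pose D a := `[< quot S (None, a) = S >].
pose G T := if `[< T = S >] then 0 else word_series A T.
pose F := mtsum c (fun a => (D a)%:R).
have D_down : downclosed (vle c) D.
  move=> a b ab /asboolP Db; apply/asboolP/funext => w; apply/idP/idP.
    exact: quot_sub.
  rewrite -{1}Db; apply: S_down; apply: emb_cons (emb_refl lle_refl w).
  by rewrite /lle eqxx.
have splitG : mtsum c (fun a => word_series A (quot S (None, a))) =
    F * word_series A S + mtsum c (fun a => G (quot S (None, a))).
  rewrite -mtsumM -mtsumD; apply: eq_mtsum => a; rewrite /D /G.
  by case: asboolP => [->|_]; rewrite ?mul1r ?addr0 // mul0r add0r.
have ratG : rational c (mtsum c (fun a => G (quot S (None, a)))).
  apply: (@rational_mtsum c _ (emb lle) G (emb_refl lle_refl) wqo_words c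
    (fun x => S ((None, x.1) :: x.2))); first exact: quot_pair_down.
  move=> a; rewrite /G; case: asboolP => [_|neq]; first exact: rational0.
  apply: IHS => //; first exact: (@quot_down S (None, a) S_down).
  exact: (@quot_sub S (None, a) S_down).
have ratL : rational c (\sum_(l <- enum A)
    mtsum c (fun a => word_series (A :\ l) (quot S (Some l, a)))).
  rewrite big_seq; apply: big_ind; [exact: rational0 | exact: rational_add |].
  move=> l; rewrite mem_enum => lA.
  apply: (@rational_mtsum c _ (emb lle) (word_series (A :\ l))
    (emb_refl lle_refl) wqo_words c (fun x => S ((Some l, x.1) :: x.2))).
    exact: quot_pair_down.
  move=> a; apply: IHk; last exact: (@quot_down S (Some l, a) S_down).
  by move: leAk; rewrite (cardsD1 l A) lA.
pose R := ser_of_poly2 ((A == set0) && S [::])%:R + s_ *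
  (mtsum c (fun a => G (quot S (None, a))) + \sum_(l <- enum A)
    mtsum c (fun a => word_series (A :\ l) (quot S (Some l, a)))).
have ratR : rational c R.
  apply: rational_add; first exact: rational_poly.
  by apply/rational_mul/rational_add.
have eqR : word_series A S = s_ * F * word_series A S + R.
  by rewrite {1}word_seriesE splitG /R; ring.
have [F0|[e [f [ec f1 f0 Ff]]]] := dickson_series D_down.
  by rewrite eqR /F F0 mulr0 mul0r add0r.
apply: (@rational_div_factor c (e, f)) => //.
have -> : ser_of_poly2 (factor (e, f)) * word_series A S = (1 - t_) ^+ e * R.
  have -> : R = word_series A S - s_ * F * word_series A S by rewrite {1}eqR; ring.
  rewrite /factor /= rmorphB rmorphM /= ser1BtX -Ff -/F; ring.
by rewrite -ser1BtX; apply: rational_mul.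
Qed.

End Words.

(** * Monomials and increasing maps *)

Lemma index_pairs (A B : eqType) (s : seq A) (r : seq B) x y : uniq s ->
    x \in s -> y \in r ->
  index (x, y) [seq (a, b) | a <- s, b <- r] = (index x s * size r + index y r)%N.
Proof.
elim: s => //= a s IH /andP[as_ us]; rewrite inE => /predU1P[->|xs] yr.
  rewrite eqxx index_cat (map_f (pair a)) // mul0n index_map //.
  by move=> b b' [].
rewrite ifN_eq; last by apply: contraNneq as_ => ->.
rewrite index_cat; case: mapP => [[b _ [xa _]]|_]; first by rewrite -xa xs in as_.
by rewrite size_map IH // mulSn addnA.
Qed.

Lemma val_mxvec_index m n (i : 'I_m) (j : 'I_n) :
  mxvec_index i j = (i * n + j)%N :> nat.
Proof.
rewrite /= -[enum_rank _]/(enum_rank (i, j)).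
have -> : nat_of_ord (enum_rank (i, j)) = index (i, j) (enum {: 'I_m * 'I_n}).
  by rewrite -[in RHS](enum_rankK (i, j)) index_uniq ?enum_uniq // -cardE.
rewrite enumT unlock /= /prod_enum index_pairs ?enum_uniq ?mem_enum //.
by rewrite !index_enum_ord size_enum_ord.
Qed.

Section Monomials.

Variable c : nat.

(** Inverse of [mxvec_index]. *)
Definition unvec n (k : 'I_(c * n)) : 'I_c * 'I_n :=
  enum_val (cast_ord (esym (mxvec_cast c n)) k).

Lemma mxvec_indexK n (i : 'I_c) (j : 'I_n) : unvec (mxvec_index i j) = (i, j).
Proof. by rewrite /unvec cast_ordK enum_rankK. Qed.

Definition finj_increasing m n (e : finj m n) :=
  forall i j : 'I_m, (i < j)%N -> (e i < e j)%N.

Definition vmap m n (e : finj m n) (k : 'I_(c * m)) : 'I_(c * n) :=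
  mxvec_index (unvec k).1 (e (unvec k).2).

Lemma vmapE m n (e : finj m n) i j :
  vmap e (mxvec_index i j) = mxvec_index i (e j).
Proof. by rewrite /vmap mxvec_indexK. Qed.

Lemma vmap_inj m n (e : finj m n) : injective (vmap e).
Proof.
move=> k l; case/mxvec_indexP: k => i j; case/mxvec_indexP: l => i' j'.
rewrite !vmapE => /(congr1 (@unvec n)); rewrite !mxvec_indexK.
by case=> -> /finjP ->.
Qed.

(** Variables are numbered row by row, and an increasing map acts within rows. *)
Lemma vmap_increasing m n (e : finj m n) (k l : 'I_(c * m)) :
  finj_increasing e -> (k < l)%N -> (vmap e k < vmap e l)%N.
Proof.
move=> e_incr; case/mxvec_indexP: k => i j; case/mxvec_indexP: l => i' j'.
rewrite !vmapE !val_mxvec_index.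
have := e_incr j j'; have := ltn_ord j; have := ltn_ord j'.
have := ltn_ord (e j); have := ltn_ord (e j').
have [ii'|ii'|->] := ltngtP (i : nat) i'; last by lia.
  have : (i.+1 * n <= i' * n)%N by rewrite leq_mul2r ii' orbT.
  by rewrite mulSn; lia.
have : (i'.+1 * m <= i * m)%N by rewrite leq_mul2r ii' orbT.
by rewrite mulSn; lia.
Qed.

(** The exponent of the image of a monomial under [fiP_map e]. *)
Definition emon m n (e : finj m n) (u : 'X_{1..c * m}) : 'X_{1..c * n} :=
  [multinom \sum_(k | vmap e k == k') u k | k' < (c * n)%N].

Lemma emon_vmap m n (e : finj m n) u k : emon e u (vmap e k) = u k.
Proof.
by rewrite mnmE (big_pred1 k) // => l; rewrite (inj_eq (@vmap_inj _ _ e)).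
Qed.

Lemma emon_out m n (e : finj m n) u k' :
  (forall k, vmap e k != k') -> emon e u k' = 0%N.
Proof. by move=> out; rewrite mnmE big1 // => k; rewrite (negbTE (out k)). Qed.

Lemma mdeg_emon m n (e : finj m n) u : mdeg (emon e u) = mdeg u.
Proof.
rewrite !mdegE (partition_big (vmap e) xpredT) //=.
by apply: eq_bigr => k _; rewrite mnmE.
Qed.

(** The order of monomials is graded lexicographic: [emon e] preserves degrees,
    moves the first difference of exponents along [vmap e], and adds zeros. *)
Lemma emon_lt m n (e : finj m n) u v : finj_increasing e ->
  (u < v)%O -> (emon e u < emon e v)%O.
Proof.
move=> e_incr uv; have := lemc_mdeg (ltW uv).
rewrite leq_eqVlt => /orP[/eqP eq_deg|]; last first.
  by rewrite -(mdeg_emon e u) -(mdeg_emon e v); apply: lt_mdeg_ltmc.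
have [i eq_lt lt_i] := ltmcP eq_deg uv.
apply/ltmcP; first by rewrite !mdeg_emon.
exists (vmap e i); last by rewrite !emon_vmap.
move=> k' lt_k'; case: (pickP (fun k => vmap e k == k')) => [k /eqP kk'|out].
  rewrite -kk' !emon_vmap; apply: eq_lt; rewrite ltnNge; apply/negP => ik.
  have := lt_k'; rewrite -kk'; move: ik; rewrite leq_eqVlt => /orP[/eqP/val_inj->|].
    by rewrite ltnn.
  by move/(vmap_increasing e_incr); lia.
by rewrite !emon_out // => k; rewrite out.
Qed.

Lemma fiP_mapXm (K : fieldType) m n (e : finj m n) (u : 'X_{1..c * m}) :
  fiP_map e ('X_[u] : fiP K c m) = 'X_[emon e u].
Proof.
rewrite /fiP_map comp_mpolyX.
rewrite (eq_bigr (fun k => ('X_[U_(vmap e k) *+ u k] : fiP K c n))) => [|k _].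
  rewrite mprodXE; congr ('X_[_]); apply/mnmP => k'.
  rewrite mnm_sumE mnmE [in RHS]big_mkcond /=; apply: eq_bigr => k _.
  by rewrite mulmnE mnm1E; case: (_ == _); rewrite ?mul1n ?mul0n.
by rewrite tnth_mktuple; case/mxvec_indexP: k => i j; rewrite mxvecE mxE vmapE mpolyXn.
Qed.

Lemma fiP_mapC (K : fieldType) m n (e : finj m n) (k : K) :
  fiP_map e (k%:MP : fiP K c m) = k%:MP.
Proof. exact: comp_mpolyC. Qed.

End Monomials.

(** * Standard terms *)

(** Each of finitely many generators lies in the submodule generated by finitely
    many of the homogeneous ones. *)
Lemma homogeneous_generators (K : fieldType) (c : nat) (M : gradedFIModule K c) :
    fi_finitely_generated M -> fi_generated_nonneg M ->
  exists (r : nat) (d : 'I_r -> nat) (g : forall i, M (d i)) (e : 'I_r -> nat),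
    (forall i, gfim_comp (e i)%:Z (g i)) /\
    forall N : (forall n, M n -> Prop), is_fi_submodule N ->
      (forall i, N (d i) (g i)) -> forall n q, N n q.
Proof.
move=> [s s_gen] [S [S_gen S_hom]].
pose in_span (l : seq {n & M n}) n (q : M n) := forall N : (forall n, M n -> Prop),
  is_fi_submodule N -> (forall n (x : M n), existT _ n x \in l -> N n x) -> N n q.
pose in_S (l : seq {n & M n}) :=
  forall n (x : M n), existT _ n x \in l -> S (existT _ n x).
have in_S_cat l1 l2 : in_S l1 -> in_S l2 -> in_S (l1 ++ l2).
  by move=> S1 S2 n x; rewrite mem_cat => /orP[/S1|/S2].
have in_span_catl l1 l2 n (q : M n) : in_span l1 n q -> in_span (l1 ++ l2) n q.
  by move=> q1 N NP Nl; apply: q1 => // m x xl; apply: Nl; rewrite mem_cat xl.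
have in_span_catr l1 l2 n (q : M n) : in_span l2 n q -> in_span (l1 ++ l2) n q.
  by move=> q1 N NP Nl; apply: q1 => // m x xl; apply: Nl; rewrite mem_cat xl orbT.
have fin n (q : M n) : exists2 l, in_S l & in_span l n q.
  apply: (S_gen (fun n q => exists2 l, in_S l & in_span l n q)) => {n q}.
    split=> [n|n q1 q2 [l1 S1 q1P] [l2 S2 q2P]|n a q [l Sl ql]|m n e q [l Sl ql]].
    - by exists [::] => // N NP _; apply: fisub0.
    - exists (l1 ++ l2); first exact: in_S_cat.
      by move=> N NP Nl; apply: (fisubD NP);
        [exact: (in_span_catl _ _ _ _ q1P N NP Nl)
         | exact: (in_span_catr _ _ _ _ q2P N NP Nl)].
    - by exists l => // N NP Nl; apply: (fisubZ NP); apply: ql.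
    - by exists l => // N NP Nl; apply: (fisub_map NP); apply: ql.
  move=> n q Sq; exists [:: existT _ n q] => [m x|N NP]; last first.
    by apply; rewrite mem_head.
  by rewrite inE => /eqP->.
have [l Sl s_l] : exists2 l, in_S l &
    forall n (x : M n), existT _ n x \in s -> in_span l n x.
  elim: (s) => [|[m y] s' [l Sl s'l]]; first by exists [::].
  have [l' Sl' yl'] := fin m y.
  exists (l' ++ l); first exact: in_S_cat.
  move=> n x; rewrite inE => /predU1P[eqx|/s'l]; last exact: in_span_catr.
  have /= -> := congr1 (fun z => in_span (l' ++ l) (tag z) (tagged z)) eqx.
  exact: in_span_catl.
pose y (i : 'I_(size l)) := tnth (in_tuple l) i.
have y_l i : existT _ (tag (y i)) (tagged (y i)) \in l.
  by have := mem_tnth i (in_tuple l); rewrite -/(y i); case: (y i).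
have /choice[e eP] (i : 'I_(size l)) :
    exists e : nat, gfim_comp e%:Z (tagged (y i)).
  have [j [j0 yj]] := S_hom _ _ (Sl _ _ (y_l i)).
  by exists `|j|%N; rewrite gez0_abs.
exists (size l), (fun i => tag (y i)), (fun i => tagged (y i)), e; split=> // N NP Ny.
apply: (s_gen N NP) => n x /s_l; apply=> // m z zl.
have [i zi] : exists i, existT _ m z = y i.
  by have /tnthP[i zi] : existT _ m z \in in_tuple l; [| exists i].
by have := Ny i; rewrite -zi.
Qed.

Section StandardTerms.

Variables (K : fieldType) (c : nat) (M : gradedFIModule K c).
Variables (r : nat) (d : 'I_r -> nat) (g : forall i, M (d i)) (e : 'I_r -> nat).
Hypothesis g_hom : forall i, gfim_comp (e i)%:Z (g i).
Hypothesis g_gen : forall N : (forall n, M n -> Prop), is_fi_submodule N ->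
  (forall i, N (d i) (g i)) -> forall n q, N n q.

Definition term n := ({i : 'I_r & finj (d i) n} * 'X_{1..c * n})%type.

Definition mk_term n i (p : finj (d i) n * 'X_{1..c * n}) : term n :=
  (Tagged (fun i => finj (d i) n) p.1, p.2).

Definition tval n (x : term n) : M n :=
  ('X_[x.2] : fiP K c n) *: fim_map (tagged x.1) (g (tag x.1)).

Definition tdeg n (x : term n) : nat := (mdeg x.2 + e (tag x.1))%N.

Lemma tval_homogeneous n (x : term n) : gfim_comp (tdeg x)%:Z (tval x).
Proof.
rewrite /tdeg PoszD; apply: gfim_compZ; first by rewrite dhomogX.
exact/gfim_comp_map/g_hom.
Qed.

Lemma gfim_compD n j (q1 q2 : M n) :
  gfim_comp j q1 -> gfim_comp j q2 -> gfim_comp j (q1 + q2).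
Proof.
move=> q1j q2j; rewrite -(opprK q2) -[- q2]add0r; apply: gfim_compB => //.
by apply: gfim_compB => //; apply: gfim_comp0.
Qed.

Lemma gfim_comp_const n j (k : K) (q : M n) :
  gfim_comp j q -> gfim_comp j ((k%:MP : fiP K c n) *: q).
Proof.
by move=> qj; rewrite -[j]add0r; apply: (@gfim_compZ _ _ _ _ 0%N) => //;
  rewrite -alg_mpolyC; apply/dhomogZ/dhomog1.
Qed.

(** Combinations are given by lists since terms of a given width are infinite in
    number. *)
Definition kspan n (P : term n -> Prop) (q : M n) :=
  exists s : seq (K * term n), (forall y, y \in s -> P y.2) /\
    q = \sum_(y <- s) (y.1%:MP : fiP K c n) *: tval y.2.

Lemma kspan0 n (P : term n -> Prop) : kspan P 0.
Proof. by exists [::]; rewrite big_nil. Qed.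

Lemma kspanD n (P : term n -> Prop) q1 q2 :
  kspan P q1 -> kspan P q2 -> kspan P (q1 + q2).
Proof.
move=> [s1 [P1 ->]] [s2 [P2 ->]]; exists (s1 ++ s2); rewrite big_cat; split=> // y.
by rewrite mem_cat => /orP[/P1|/P2].
Qed.

Lemma kspanZ n (P : term n -> Prop) (k : K) q :
  kspan P q -> kspan P ((k%:MP : fiP K c n) *: q).
Proof.
move=> [s [Ps ->]]; exists [seq (k * y.1, y.2) | y <- s]; split.
  by move=> _ /mapP[y ys ->]; exact: (Ps y ys).
rewrite big_map scaler_sumr; apply: eq_bigr => y _.
by rewrite mpolyCM scalerA.
Qed.

Lemma kspan_sum n (P : term n -> Prop) (I : Type) (s : seq I) (Q : pred I) F :
  (forall i, Q i -> kspan P (F i)) -> kspan P (\sum_(i <- s | Q i) F i).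
Proof. by move=> PF; apply: big_ind; [apply: kspan0 | apply: kspanD |]. Qed.

Lemma kspan_tval n (P : term n -> Prop) x : P x -> kspan P (tval x).
Proof.
move=> Px; exists [:: (1, x)]; rewrite big_seq1 mpolyC1 scale1r; split=> // y.
by rewrite inE => /eqP->.
Qed.

Lemma kspan_map m n (P : term m -> Prop) (Q : term n -> Prop) (f : M m -> M n) :
    f 0 = 0 -> {morph f : x y / x + y} ->
    (forall (k : K) q, f ((k%:MP : fiP K c m) *: q) = (k%:MP : fiP K c n) *: f q) ->
    (forall x, P x -> kspan Q (f (tval x))) ->
  forall q, kspan P q -> kspan Q (f q).
Proof.
move=> f0 fD fZ PQ q [s [Ps ->]].
rewrite (big_morph f fD f0) big_seq; apply: kspan_sum => y /Ps Py.
by rewrite fZ; apply/kspanZ/PQ.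
Qed.

Lemma kspan_trans n (P Q : term n -> Prop) q :
  kspan P q -> (forall x, P x -> kspan Q (tval x)) -> kspan Q q.
Proof. by move=> Pq PQ; apply: (kspan_map (f := id)) Pq. Qed.

Lemma fim_map0 m n (f : finj m n) : fim_map f (0 : M m) = 0.
Proof. by apply: (addrI (fim_map f 0)); rewrite -fim_mapD !addr0. Qed.

Definition tact m n (f : finj m n) (v : 'X_{1..c * n}) (x : term m) : term n :=
  mk_term (finj_comp f (tagged x.1), (v + emon f x.2)%MM).

Lemma tval_act m n (f : finj m n) v (x : term m) :
  tval (tact f v x) = ('X_[v] : fiP K c n) *: fim_map f (tval x).
Proof. by rewrite /tval /= fim_map_comp fim_mapZ fiP_mapXm scalerA mpolyXD. Qed.

Lemma tdeg_act m n (f : finj m n) v (x : term m) :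
  tdeg (tact f v x) = (mdeg v + tdeg x)%N.
Proof. by rewrite /tdeg /= mdegD mdeg_emon addnA. Qed.

Lemma kspan_act m n (P : term m -> Prop) (Q : term n -> Prop) f v q :
  (forall x, P x -> Q (tact f v x)) ->
  kspan P q -> kspan Q (('X_[v] : fiP K c n) *: fim_map f q).
Proof.
move=> PQ; apply: (kspan_map (f := fun q => ('X_[v] : fiP K c n) *: fim_map f q)).
- by rewrite fim_map0 scaler0.
- by move=> x y; rewrite fim_mapD scalerDr.
- by move=> k x; rewrite fim_mapZ fiP_mapC !scalerA mulrC.
- by move=> x Px; rewrite -tval_act; apply/kspan_tval/PQ.
Qed.

Lemma fim_map_idE n (q : M n) : fim_map (finj_id n) q = q.
Proof. exact: fim_map_id. Qed.

Lemma kspan_all n (q : M n) : kspan (fun=> True) q.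
Proof.
apply: (g_gen (N := fun n q => kspan (fun=> True) q)) => {n q}.
  split=> [n|n q1 q2|n a q qT|m n f q]; [exact: kspan0 | exact: kspanD | | ].
    rewrite [a]mpolyE scaler_suml; apply: kspan_sum => m _.
    rewrite -mul_mpolyC -scalerA; apply: kspanZ.
    by rewrite -[q]fim_map_idE; apply: kspan_act qT.
  by move=> qT; rewrite -[fim_map f q]scale1r -mpolyX0; apply: kspan_act qT.
move=> i; rewrite -[g i]fim_map_idE -[fim_map _ _]scale1r -mpolyX0.
exact: (@kspan_tval _ _ (mk_term (finj_id (d i), 0%MM))).
Qed.

(** In an expression of a homogeneous element by terms, those of any other degree
    cancel, the sum of the graded components being direct. *)
Lemma kspan_homogeneous n (j : int) (q : M n) : gfim_comp j q ->
  kspan (fun x => (tdeg x)%:Z = j) q.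
Proof.
move=> qj; have [s [_ qE]] := kspan_all q.
pose part (i : int) : M n :=
  \sum_(y <- s | (tdeg y.2)%:Z == i) (y.1%:MP : fiP K c n) *: tval y.2.
pose y i := part i - (if i == j then q else 0).
pose J := undup (j :: [seq (tdeg y.2)%:Z | y <- s]).
have part_hom i : gfim_comp i (part i).
  rewrite /part; elim/big_rec: _ => [|x q' /eqP <- q'i]; first exact: gfim_comp0.
  by apply: gfim_compD q'i; apply/gfim_comp_const/tval_homogeneous.
have y_hom i : gfim_comp i (y i).
  apply: gfim_compB => //; case: eqP => [->|_] //; exact: gfim_comp0.
have jJ : j \in J by rewrite mem_undup mem_head.
have sum0 : \sum_(i <- J) y i = 0.
  have sum_q : \sum_(i <- J) (if i == j then q else 0) = q.
    rewrite (bigD1_seq j) ?undup_uniq //= eqxx big1 ?addr0 // => i /negbTE->.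
    by [].
  rewrite sumrB sum_q.
  apply/eqP; rewrite subr_eq0; apply/eqP; rewrite /part.
  rewrite (exchange_big_dep xpredT) //= qE big_seq [RHS]big_seq.
  apply: eq_bigr => x xs.
  rewrite big_mkcond (bigD1_seq (tdeg x.2)%:Z) ?undup_uniq //=; last first.
    by rewrite mem_undup inE map_f ?orbT.
  by rewrite eqxx big1 ?addr0 // => i; rewrite eq_sym => /negbTE->.
have := gfim_direct (undup_uniq _) y_hom sum0 jJ.
rewrite /y eqxx => /eqP; rewrite subr_eq0 => /eqP <-.
exists [seq y <- s | (tdeg y.2)%:Z == j]; rewrite big_filter; split=> // x.
by rewrite mem_filter => /andP[/eqP].
Qed.

(** Terms are compared by generator, monomial and map, in this order; what
    matters is that [tact f v] is strictly monotone for increasing [f]. *)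
Definition key n (x : term n) : (nat *l ('X_{1..c * n} *l seqlexi nat))%type :=
  (val (tag x.1), (x.2, [seq val (tagged x.1 l) | l <- enum 'I_(d (tag x.1))])).

Lemma key_inj n : injective (@key n).
Proof.
move=> [[i p] u] [[i' p'] u']; rewrite /key /= => -[/val_inj ii' -> ].
case: _ / ii' p' => p' eq_map; congr (existT _ _ _, _).
apply/val_inj/ffunP => l; apply: val_inj.
have := congr1 (fun s => nth 0%N s l) eq_map.
by rewrite !(nth_map l) -?enumT ?size_enum_ord // nth_ord_enum.
Qed.

Definition tlt n (x y : term n) := (key x < key y)%O.

Lemma seqlexi_map_lt (f : nat -> nat) (s1 s2 : seq nat) :
    {in s1 & s2, forall x y, (x < y)%N -> (f x < f y)%N} ->
  ((s1 : seqlexi nat) < s2)%O -> ((map f s1 : seqlexi nat) < map f s2)%O.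
Proof.
elim: s1 s2 => [|x s1 IH] [|y s2] //= f_incr.
rewrite !ltxi_cons !leEnat => /andP[xy /implyP lt12].
have f_tail : {in s1 & s2, forall x y, (x < y)%N -> (f x < f y)%N}.
  by move=> a b a1 b2; apply: f_incr; rewrite inE (a1, b2) orbT.
move: xy; rewrite leq_eqVlt => /predU1P[xy|xy].
  by rewrite xy !leqnn /=; apply: IH => //; apply: lt12; rewrite xy.
have fxy := f_incr x y (mem_head _ _) (mem_head _ _) xy.
by rewrite ltnW //= leqNgt fxy.
Qed.

Lemma tact_lt m n (f : finj m n) v (x y : term m) : finj_increasing f ->
  tlt x y -> tlt (tact f v x) (tact f v y).
Proof.
move=> f_incr; rewrite /tlt /key /= !ltxi_pair !leEnat.
case/andP=> -> /implyP lt2; apply/implyP => /lt2 {lt2}.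
case/andP=> le_u /implyP lt_p.
move: le_u; rewrite le_eqVlt => /predU1P[eq_u|lt_u]; last first.
  have lt_a : ((v + emon f x.2)%MM < (v + emon f y.2)%MM)%O.
    by rewrite ltmc_add2r emon_lt.
  by rewrite (ltW lt_a) leNgt lt_a.
rewrite eq_u lexx /=.
have mapE (z : term m) :
    [seq val (finj_comp f (tagged z.1) l) | l <- enum 'I_(d (tag z.1))]
    = [seq (if insub k is Some k' then val (f k') else 0%N) | k <-
       [seq val (tagged z.1 l) | l <- enum 'I_(d (tag z.1))]].
  by rewrite -map_comp; apply: eq_map => l /=; rewrite ffunE valK.
rewrite !mapE; apply: seqlexi_map_lt; last by apply: lt_p; rewrite eq_u.
move=> _ _ /mapP[l _ ->] /mapP[l' _ ->]; rewrite !valK; exact: f_incr.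
Qed.

(** Reference to terms of the same degree only makes bases compatible with the
    grading, and remains meaningful after transport by [tact f v], which shifts
    all degrees alike. *)
Definition standard n (x : term n) :=
  ~ kspan (fun y => tlt y x /\ tdeg y = tdeg x) (tval x).

(** A relation expressing [x] by smaller terms is carried by [tact f v] to one
    for [tact f v x]. *)
Lemma standard_act m n (f : finj m n) v (x : term m) :
  finj_increasing f -> standard (tact f v x) -> standard x.
Proof.
move=> f_incr std_fx x_low; apply: std_fx; rewrite tval_act.
apply: kspan_act x_low => y [yx deg_yx]; split; first exact: tact_lt.
by rewrite !tdeg_act deg_yx.
Qed.

(** * Bases of standard terms *)

Definition pairs n i k : seq (finj (d i) n * 'X_{1..c * n}) :=
  [seq p <- [seq (x.1, bmnm x.2) |
      x <- enum {: finj (d i) n * 'X_{1..(c * n)%N < k.+1}}] | mdeg p.2 == k].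

Lemma mem_pairs n i k p : (p \in @pairs n i k) = (mdeg p.2 == k).
Proof.
case: p => p u; rewrite mem_filter /=; case: eqP => //= uk; apply/mapP.
have uk' : (mdeg u < k.+1)%N by rewrite uk.
by exists (p, BMultinom uk'); rewrite ?mem_enum.
Qed.

Lemma pairs_uniq n i k : uniq (@pairs n i k).
Proof.
rewrite filter_uniq // map_inj_uniq ?enum_uniq // => -[p u] [p' u'] [-> uu'].
by congr (_, _); apply: val_inj.
Qed.

Definition terms n (j : nat) : seq (term n) :=
  [seq mk_term p | i <- [seq i <- enum 'I_r | (e i <= j)%N],
                   p <- pairs n i (j - e i)%N].

Lemma mem_terms n j (x : term n) : (x \in terms n j) = (tdeg x == j).
Proof.
apply/allpairsPdep/eqP => [[i [p []]]|<-].
  rewrite mem_filter mem_enum andbT mem_pairs => ij /eqP pj ->.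
  by rewrite /tdeg /= pj subnK.
exists (tag x.1), (tagged x.1, x.2); rewrite mem_filter mem_enum mem_pairs /tdeg.
rewrite leq_addl addnK; split=> //.
by case: x => [[i p] u].
Qed.

Lemma terms_uniq n j : uniq (terms n j).
Proof.
apply: allpairs_uniq_dep => [|i _|].
- by rewrite filter_uniq // enum_uniq.
- exact: pairs_uniq.
pose back (x : term n) : {i : 'I_r & (finj (d i) n * 'X_{1..c * n})%type} :=
  existT _ (tag x.1) (tagged x.1, x.2).
move=> x y _ _ /(congr1 back); rewrite /back /=.
by case: x => i [p u]; case: y => i' [p' u'].
Qed.

Definition std_basis n j := [seq x <- terms n j | `[< standard x >]].

Lemma mem_std_basis n j x : (x \in std_basis n j) = `[< standard x >] && (tdeg x == j).
Proof. by rewrite mem_filter mem_terms. Qed.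

Lemma kspan_std_basis n j x :
  tdeg x = j -> kspan (fun y => y \in std_basis n j) (tval x).
Proof.
pose below (x : term n) := [seq y <- terms n j | (key y < key x)%O].
have [k] := ubnP (size (below x)); elim: k x => // k IH x lt_k xj.
have [std|/contrapT x_low] := pselect (standard x).
  by apply: kspan_tval; rewrite mem_std_basis xj eqxx andbT; apply/asboolP.
apply: kspan_trans x_low _ => y [yx deg_yx]; apply: IH; last by rewrite deg_yx.
rewrite ltnS in lt_k; apply: leq_trans lt_k.
have -> : below y = [seq z <- below x | (key z < key y)%O].
  rewrite /below -filter_predI; apply: eq_filter => z /=.
  by case zy: (key z < key y)%O => //; rewrite (lt_trans zy yx).
rewrite size_filter -(count_predC (fun z => (key z < key y)%O) (below x)).
rewrite -addn1 leq_add2l -has_count; apply/hasP; exists y; last by rewrite /= ltxx.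
by rewrite mem_filter mem_terms deg_yx xj eqxx andbT.
Qed.

(** A nonstandard term reduces to smaller ones, and the largest term of a linear
    relation is not standard. *)
Lemma has_dim_std_basis n j :
  has_dim (fun q : M n => gfim_comp j%:Z q) (size (std_basis n j)).
Proof.
pose b i := tnth (in_tuple (std_basis n j)) i.
have bP i : b i \in std_basis n j by apply: mem_tnth.
have b_inj : injective b.
  by apply/tuple_uniqP; rewrite filter_uniq ?terms_uniq.
exists (fun i => tval (b i)); split.
- move=> i; have := bP i; rewrite mem_std_basis => /andP[_ /eqP <-].
  exact: tval_homogeneous.
- move=> k sum0 i0; apply/eqP; apply: contraT => k0.
  have [i ki i_max] := @Order.TotalTheory.arg_maxP _ _ _ i0
    (fun i => k i != 0) (fun i => key (b i)) k0.
  have := bP i; rewrite mem_std_basis => /andP[/asboolP std_i /eqP deg_i]; case: std_i.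
  have -> : tval (b i) = \sum_(i' | i' != i)
      ((- ((k i)^-1 * k i'))%:MP : fiP K c n) *: tval (b i').
    have := congr1 (fun q => (((k i)^-1)%:MP : fiP K c n) *: q) sum0.
    rewrite (bigD1 i) //= scalerDr scaler0 scalerA -mpolyCM mulVf // mpolyC1 scale1r.
    move/eqP; rewrite addr_eq0 => /eqP->; rewrite scaler_sumr -sumrN.
    by apply: eq_bigr => i' _; rewrite mpolyCN mpolyCM scaleNr scalerA.
  apply: kspan_sum => i' ii'; have [->|ki'] := eqVneq (k i') 0.
    by rewrite mulr0 oppr0 mpolyC0 scale0r; apply: kspan0.
  apply/kspanZ/kspan_tval; split.
    have le_i : (key (b i') <= key (b i))%O := i_max _ ki'.
    rewrite /tlt lt_neqAle le_i andbT.
    by apply: contraNneq ii' => /key_inj /b_inj ->.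
  by have := bP i'; rewrite mem_std_basis => /andP[_ /eqP ->].
- move=> q /kspan_homogeneous qj.
  have {qj}[s [s_basis ->]] : kspan (fun y => y \in std_basis n j) q.
    by apply: kspan_trans qj _ => x [xj]; apply: kspan_std_basis.
  elim: s s_basis => [|[a x] s IH] s_basis.
    exists (fun=> 0); rewrite big_nil big1 // => i _.
    by rewrite mpolyC0 scale0r.
  have [k sE] : exists k : 'I_(size (std_basis n j)) -> K,
      \sum_(y <- s) (y.1%:MP : fiP K c n) *: tval y.2 =
      \sum_i ((k i)%:MP : fiP K c n) *: tval (b i).
    by apply: IH => y ys; apply: s_basis; rewrite inE ys orbT.
  have /tnthP[i0 xi0] : x \in in_tuple (std_basis n j).
    by apply: (s_basis (a, x)); rewrite mem_head.
  exists (fun i => (if i == i0 then a else 0) + k i).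
  rewrite big_cons sE /= xi0 -/(b i0).
  under [RHS]eq_bigr do rewrite mpolyCD scalerDl.
  rewrite big_split /= [X in _ = X + _](bigD1 i0) //= eqxx.
  rewrite [X in _ = (_ + X) + _]big1 ?addr0 // => i /negbTE->.
  by rewrite mpolyC0 scale0r.
Qed.

Lemma has_dim_negative n (j : int) : j < 0 ->
  has_dim (fun q : M n => gfim_comp j q) 0.
Proof.
move=> j0; exists (fun _ => 0); split=> [[]//|k _ []//|q].
move=> /kspan_homogeneous[s [sj ->]].
exists (fun=> 0); rewrite big_ord0; case: s sj => [|y s] sj; first by rewrite big_nil.
by have := sj y (mem_head _ _); lia.
Qed.

End StandardTerms.

(** * Terms as words *)

Lemma emb_nth (A : Type) (le : rel A) (x0 : A) (u v : seq A) : emb le u v ->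
  exists f : nat -> nat,
    [/\ forall i j, (i < j)%N -> (f i < f j)%N,
        forall i, (i < size u)%N -> (f i < size v)%N
      & forall i, (i < size u)%N -> le (nth x0 u i) (nth x0 v (f i))].
Proof.
elim: v u => [|y v IH] u; first by case: u => // _; exists id.
move=> /= /orP[/IH[f [f_incr fv le_f]]|].
  by exists (fun i => (f i).+1); split=> // i j /f_incr.
case: u => [_|x u /andP[xy /IH[f [f_incr fv le_f]]]]; first by exists id.
exists (fun i => if i is i'.+1 then (f i').+1 else 0%N).
split=> [[|i] [|j]|[|i]|[|i]] //.
- exact: (f_incr i j).
- exact: (fv i).
- exact: (le_f i).
Qed.

Lemma labels_nth (L : finType) (w : seq (letter L)) x0 i j l :
    uniq (labels w) -> (i < size w)%N -> (j < size w)%N ->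
    (nth x0 w i).1 = Some l -> (nth x0 w j).1 = Some l -> i = j.
Proof.
have mem_labels (v : seq (letter L)) k : (k < size v)%N ->
    (nth x0 v k).1 = Some l -> l \in labels v.
  by move=> kv kl; rewrite mem_pmap -kl map_f // mem_nth.
elim: w i j => // -[o a] w IH [|i] [|j] //=.
- move=> + _ jw ol; rewrite ol /= => /andP[lw _] /(mem_labels _ _ jw).
  by rewrite (negbTE lw).
- move=> + iw _ + ol; rewrite ol /= => /andP[lw _] /(mem_labels _ _ iw).
  by rewrite (negbTE lw).
move=> uw iw jw il jl; congr _.+1; apply: IH => //.
by case: (o) uw => //= l' /andP[].
Qed.

Section Codes.

Variables (c D : nat).

Definition label n (p : finj D n) (j : 'I_n) : option 'I_D :=
  [pick l | p l == j].

Definition code n (x : finj D n * 'X_{1..c * n}) : seq (letter 'I_D) :=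
  [seq (label x.1 j, [seq x.2 (mxvec_index i j) | i <- enum 'I_c]) | j <- enum 'I_n].

Lemma labelE n (p : finj D n) j l : (label p j == Some l) = (p l == j).
Proof.
rewrite /label; case: pickP => [l' /eqP <-|none]; last by rewrite none.
by rewrite (inj_eq (@finjP _ _ p)); apply/eqP/eqP => [[->]|->].
Qed.

Lemma size_code n (x : finj D n * 'X_{1..c * n}) : size (code x) = n.
Proof. by rewrite size_map size_enum_ord. Qed.

Lemma nth_code x0 n (x : finj D n * 'X_{1..c * n}) (j : 'I_n) : nth x0 (code x) j =
  (label x.1 j, [seq x.2 (mxvec_index i j) | i <- enum 'I_c]).
Proof. by rewrite (nth_map j) ?size_enum_ord // nth_ord_enum. Qed.

Lemma nth_exponents n (u : 'X_{1..c * n}) (i : 'I_c) (j : 'I_n) :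
  nth 0%N [seq u (mxvec_index i j) | i <- enum 'I_c] i = u (mxvec_index i j).
Proof. by rewrite (nth_map i) ?size_enum_ord // nth_ord_enum. Qed.

Lemma code_inj n : injective (@code n).
Proof.
move=> [p u] [q v] eq_code.
have eq_nth (j : 'I_n) : nth (None, [::]) (code (p, u)) j =
    nth (None, [::]) (code (q, v)) j by rewrite eq_code.
congr (_, _).
  apply/val_inj/ffunP => l; apply/esym/eqP; rewrite -[_ == _]labelE.
  have := eq_nth (p l); rewrite !nth_code => -[<- _].
  by rewrite labelE.
apply/mnmP => k; case/mxvec_indexP: k => i j.
have := eq_nth j; rewrite !nth_code => -[_ eq_exp].
by rewrite -!nth_exponents; congr nth.
Qed.

Lemma mdeg_vec n (u : 'X_{1..c * n}) :
  mdeg u = (\sum_(j < n) \sum_(i < c) u (mxvec_index i j))%N.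
Proof.
rewrite exchange_big pair_big mdegE.
rewrite (reindex _ (curry_mxvec_bij c n)) /=.
by apply: eq_bigr => -[i j].
Qed.

Lemma sumn_code n (x : finj D n * 'X_{1..c * n}) :
  sumn [seq sumn y.2 | y <- code x] = mdeg x.2.
Proof.
rewrite mdeg_vec -map_comp sumnE big_map enumT; apply: eq_bigr => j _ /=.
by rewrite sumnE big_map enumT.
Qed.

Lemma code_word n (x : finj D n * 'X_{1..c * n}) :
  code x \in words c n [set: 'I_D] (mdeg x.2).
Proof.
rewrite mem_words /is_word size_code eqxx sumn_code eqxx /=; apply/and3P; split.
- by apply/allP => _ /mapP[j _ ->]; rewrite size_map size_enum_ord.
- rewrite /labels /code; elim: (enum 'I_n) (enum_uniq 'I_n) => //= j s IH /andP[js us].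
  case: (label x.1 j) (labelE x.1 j) => [l|] /= lE; last exact: IH.
  rewrite IH // andbT mem_pmap -map_comp; apply: contra js => /mapP[k ks /= /esym/eqP].
  by rewrite labelE; have := lE l; rewrite eqxx => /esym/eqP-> /eqP->.
- rewrite eq_sym; apply/eqP/setP => l; rewrite !inE mem_pmap -map_comp.
  apply/mapP; exists (x.1 l); first by rewrite mem_enum.
  by apply/esym/eqP; rewrite /= labelE.
Qed.

(** The map is read off from the positions of the labels. *)
Lemma word_code n j w : w \in words c n [set: 'I_D] j ->
  exists2 x : finj D n * 'X_{1..c * n}, code x = w & mdeg x.2 = j.
Proof.
rewrite mem_words => /and5P[/eqP sw /allP wc /eqP wj uw /eqP all_labels].
pose x0 : letter 'I_D := (None, [::]).
have pos l : exists j : 'I_n, (nth x0 w j).1 = Some l.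
  have : l \in labels w by have := in_setT l; rewrite all_labels inE.
  rewrite mem_pmap => /mapP[y yw ly].
  have yi : (index y w < n)%N by rewrite -sw index_mem.
  by exists (Ordinal yi); rewrite /= nth_index.
have [p0 p0P] := choice pos.
have p0_inj : injectiveb [ffun l => p0 l].
  apply/injectiveP => l l'; rewrite !ffunE => pll'.
  by have := p0P l; rewrite pll' p0P => -[].
pose p := FInj p0_inj.
pose u : 'X_{1..c * n} :=
  [multinom nth 0%N (nth x0 w (unvec k).2).2 (unvec k).1 | k < (c * n)%N].
have codeE : code (p, u) = w.
  apply: (@eq_from_nth _ x0) => [|k]; rewrite size_code ?sw // => kn.
  rewrite -[k]/(nat_of_ord (Ordinal kn)) nth_code; set k' := Ordinal kn.
  have -> : [seq u (mxvec_index i k') | i <- enum 'I_c] = (nth x0 w k').2.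
    have szc : size (nth x0 w k').2 = c by apply/eqP/wc/mem_nth; rewrite sw.
    apply: (@eq_from_nth _ 0%N) => [|i]; first by rewrite size_map size_enum_ord szc.
    rewrite size_map size_enum_ord => ic.
    by rewrite -[i]/(nat_of_ord (Ordinal ic)) nth_exponents mnmE mxvec_indexK.
  rewrite [RHS]surjective_pairing; congr (_, _).
  case nth_l: (nth x0 w k').1 => [l|].
    apply/eqP; rewrite labelE; apply/eqP/val_inj; rewrite /= ffunE.
    by apply: (labels_nth uw _ _ (p0P l) nth_l); rewrite sw.
  rewrite /label; case: pickP => // l /eqP pl; have := p0P l.
  by rewrite -[p0 l](ffunE p0) -[X in nth x0 w X]/(nat_of_ord (p l)) pl nth_l.
exists (p, u); first exact: codeE.
by rewrite -sumn_code codeE wj.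
Qed.

(** Embeddings of words are divisibilities of terms: each label occurs once, so
    that an embedding matches the labelled letters. *)
Lemma emb_code m n (x : finj D m * 'X_{1..c * m}) (y : finj D n * 'X_{1..c * n}) :
    emb (lle c) (code x) (code y) ->
  exists (f : finj m n) (v : 'X_{1..c * n}),
    finj_increasing f /\ y = (finj_comp f x.1, (v + emon f x.2)%MM).
Proof.
move=> /(emb_nth (None, [::])); rewrite !size_code => -[f0 [f0_incr f0n le_f0]].
pose f1 (j : 'I_m) : 'I_n := Ordinal (f0n j (ltn_ord j)).
have f_inj : injectiveb [ffun j => f1 j].
  apply/injectiveP => j k; rewrite !ffunE => /(congr1 val) /= fjk; apply: val_inj => /=.
  by have [/f0_incr|/f0_incr|//] := ltngtP (j : nat) k; rewrite fjk ltnn.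
pose f := FInj f_inj.
have f_incr : finj_increasing f by move=> j k /f0_incr; rewrite !ffunE.
have le_f (j : 'I_m) : label x.1 j = label y.1 (f j) /\
    forall i, (x.2 (mxvec_index i j) <= y.2 (mxvec_index i (f j)))%N.
  have := le_f0 j (ltn_ord j); rewrite nth_code -[f0 j]/(nat_of_ord (f1 j)) nth_code.
  rewrite -[f1 j](ffunE f1) -/(f j) => /andP[/eqP /= -> /vleP le_exp]; split=> // i.
  by have := le_exp i (ltn_ord i); rewrite /= !nth_exponents.
exists f, (y.2 - emon f x.2)%MM; split=> //.
have le_u : (emon f x.2 <= y.2)%MM.
  apply/mnm_lepP => k'; case: (pickP (fun k => vmap f k == k')) => [k /eqP <-|out].
    rewrite emon_vmap; case/mxvec_indexP: k => i j; rewrite vmapE.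
    by case: (le_f j).
  by rewrite emon_out // => k; rewrite out.
rewrite submK // [LHS]surjective_pairing; congr (_, _).
apply/val_inj/ffunP => l; rewrite ffunE; apply/eqP; rewrite -[_ == _]labelE.
by have [<- _] := le_f (x.1 l); rewrite labelE.
Qed.

End Codes.

(** * The Hilbert series *)

Lemma count_flatten_map (A B : Type) (P : pred B) (F : A -> seq B) (s : seq A) :
  count P (flatten [seq F a | a <- s]) = (\sum_(a <- s) count P (F a))%N.
Proof.
by elim: s => [|a s IH]; rewrite ?big_nil // big_cons /= count_cat IH.
Qed.

Lemma ser_mul_tX e F n j : (t_ ^+ e * F) n j = if (e <= j)%N then F n (j - e)%N else 0.
Proof.
elim: e j => [|e IH] j; first by rewrite expr0 mul1r subn0.
by rewrite exprS -mulrA ser_mul_t; case: j => // j; rewrite IH.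
Qed.

Section StandardWords.

Variables (K : fieldType) (c : nat) (M : gradedFIModule K c).
Variables (r : nat) (d : 'I_r -> nat) (g : forall i, M (d i)) (e : 'I_r -> nat).

(** The down-closure of the codes of the standard terms on the [i]-th generator,
    which has no further codes as [standard_wordsE] shows. *)
Definition standard_words i : pred (seq (letter 'I_(d i))) := fun w =>
  `[< exists n (x : finj (d i) n * 'X_{1..c * n}),
        standard g e (mk_term x) /\ emb (lle c) w (code x) >].

Lemma standard_words_down i : downclosed (emb (lle c)) (@standard_words i).
Proof.
move=> u v uv /asboolP[n [x [std_x vx]]]; apply/asboolP; exists n, x; split=> //.
exact: (emb_trans (@lle_trans _ _) uv vx).
Qed.

Lemma standard_wordsE n i (x : finj (d i) n * 'X_{1..c * n}) :
  standard_words (code x) = `[< standard g e (mk_term x) >].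
Proof.
apply/asboolP/asboolP => [[m [y [std_y /emb_code[f [v [f_incr yE]]]]]]|std_x].
  by move: std_y; rewrite yE; apply: (@standard_act _ _ _ _ _ _ _ _ _ f v (mk_term x)).
by exists n, x; split=> //; apply/emb_refl/lle_refl.
Qed.

Lemma size_std_basis n j : size (std_basis g e n j) =
  (\sum_(i < r) if e i <= j then
     count (@standard_words i) (words c n [set: 'I_(d i)] (j - e i)) else 0)%N.
Proof.
rewrite size_filter /terms count_flatten_map big_filter enumT -big_mkcond /=.
apply: eq_bigr => i _; rewrite count_map.
have /permP <- : perm_eq (map (@code c (d i) n) (pairs c d n i (j - e i)%N))
    (words c n [set: 'I_(d i)] (j - e i)%N).
  apply: uniq_perm; rewrite ?words_uniq ?map_inj_uniq ?pairs_uniq //.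
    exact: code_inj.
  move=> w; apply/mapP/idP => [[x]|/word_code[x <- xj]].
    by rewrite mem_pairs => /eqP <- ->; apply: code_word.
  by exists x; rewrite ?mem_pairs ?xj.
by rewrite count_map; apply: eq_count => x /=; rewrite standard_wordsE.
Qed.

Lemma rational_std_basis :
  rational c (fun n j => (size (std_basis g e n j))%:Z : int).
Proof.
have -> : (fun n j => (size (std_basis g e n j))%:Z : int) =
    \sum_(i < r) ser_of_poly2 ('X%:P ^+ e i) *
      word_series c [set: 'I_(d i)] (@standard_words i) :> ser2.
  apply: ser2P => n j; rewrite size_std_basis 2!fps_sum.
  rewrite (big_morph Posz PoszD (erefl (Posz 0))).
  by apply: eq_bigr => i _; rewrite rmorphXn /= ser_mul_tX; case: ifP.
apply: rational_sum => i; apply: rational_mul.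
exact/rational_words/standard_words_down.
Qed.

End StandardWords.

Theorem corollary5p12 (K : fieldType) (c : nat) (hc : (1 <= c)%N)
    (M : gradedFIModule K c)
    (Mfg : fi_finitely_generated M) (Mnonneg : fi_generated_nonneg M) :
  exists h : nat -> int -> nat,
    [/\ is_hilbert_function M h,
        forall n (j : int), j < 0 -> h n j = 0%N
      & exists (a b : nat) (cs : 'I_b -> nat) (f : 'I_b -> {poly int})
               (g : {poly {poly int}}),
          [/\ forall j, (cs j <= c)%N,
              forall j, 0 < (f j).[1],
              forall j, (f j).[0] = 1
            & biseries_is_quotient (fun n j => (h n j%:Z)%:Z)
                g (hilbert_denominator a cs f)]].
Proof.
have [r [d [g [e [g_hom g_gen]]]]] := homogeneous_generators Mfg Mnonneg.
exists (fun n j => if j is Posz j' then size (std_basis g e n j') else 0%N); split.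
- move=> n [j|j]; first exact: has_dim_std_basis.
  exact: (has_dim_negative g_hom g_gen).
- by move=> n [].
have [a [l [p [l_ok pE]]]] := rational_std_basis g e.
pose x (j : 'I_(size l)) := tnth (in_tuple l) j.
have x_ok j : factor_ok c (x j) by apply/l_ok/mem_tnth.
exists a, (size l), (fun j => (x j).1), (fun j => (x j).2), p.
have denE :
    hilbert_denominator a (fun j => (x j).1) (fun j => (x j).2) = denominator a l.
  rewrite /hilbert_denominator /denominator; congr (_ * _).
  by rewrite [RHS]big_tnth.
split=> [j|j|j|]; try by case: (x_ok j).
split.
  rewrite denE /denominator -!horner_coef0 hornerM hornerC horner_prod hornerM.
  rewrite horner_exp !hornerE expr1n mul1r.
  rewrite (big_morph (fun q : {poly int} => q.[0]) (fun q1 q2 => hornerM q1 q2 0)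
    (hornerC 1 0)).
  rewrite big1 ?unitr1 // => y _.
  by rewrite /factor !hornerE expr1n.
move=> n j; rewrite biseries_mulE denE.
have -> : biseries_of_poly (denominator a l) = ser_of_poly2 (denominator a l) :> ser2.
  by apply: ser2P => k m; rewrite ser_of_poly2E.
by rewrite pE ser_of_poly2E.
Qed.
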